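(* Let $\alpha\in\mathbb{C}$ and let $T^\alpha$ be the automorphism of $Q(\mathcal{C})$ determined by $T^\alpha\{f(t)\}=\{e^{\alpha t}f(t)\}$ for $f\in\mathcal{C}$. For every convergent power series $\sum_{n=0}^\infty\alpha_nX^n\in\mathbb{C}\{X\}$, $$T^\alpha\left(\sum_{n=0}^\infty\alpha_nl^n\right)=\sum_{n=0}^\infty\beta_nl^n,$$ where the $\beta_n$ are determined by $$\sum_{n=0}^\infty\beta_nZ^n=\sum_{n=0}^\infty\alpha_n\left(\frac{Z}{1-\alpha Z}\right)^n\in\mathbb{C}\{Z\},$$ and $$\frac{d}{ds}\left(\sum_{n=0}^\infty\alpha_nl^n\right)=\sum_{n=1}^\infty -n\alpha_nl^{n+1}.$$ Therefore $\mathbb{C}\{l\}$ is a DT subring of $(Q(\mathcal{C}),\frac{d}{ds},T^\alpha)$, and its quotient field $Q(\mathbb{C}\{l\})$ is a DT subfield. Moreover, $Q(\mathbb{C}\{l\})$ may be regarded as a DT subfield of the field $\mathbb{C}((l))$ of formal Laurent series: the field embedding $Q(\mathbb{C}\{l\})\hookrightarrow\mathbb{C}((l))$ induced by sending $\sum_{n=0}^\infty\alpha_nl^n\in\mathbb{C}\{l\}$ to the formal power series with the same coefficients commutes with the derivations and the transforming operators, where $\mathbb{C}((l))$ carries the derivation $\sum_n\alpha_nl^n\mapsto\sum_n -n\alpha_nl^{n+1}$ and the transforming operator given by the substitution $l\mapsto l/(1-\alpha l)$.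
   Context: $\mathcal{C}$ is the set of complex-valued continuous functions on $[0,\infty)$; $f\in\mathcal{C}$ is written $\{f(t)\}$. It is a commutative ring without identity under pointwise addition and the convolution product $\{f(t)\}\{g(t)\}=\{\int_0^t f(t-u)g(u)\,du\}$. By Titchmarsh's theorem it has no zero divisors, and $Q(\mathcal{C})$ denotes its field of fractions; $a\in\mathcal{C}$ is identified with $ab/b$ for any nonzero $b\in\mathcal{C}$. A complex number $\gamma$ is identified with $\{\gamma\}/\{1\}\in Q(\mathcal{C})$, which makes $\mathbb{C}$ a subfield of $Q(\mathcal{C})$. Put $l=\{1\}\in\mathcal{C}$ (the constant function $1$) and $s=1/l\in Q(\mathcal{C})$. Convergence in $Q(\mathcal{C})$: a sequence $(a_n)$ in $Q(\mathcal{C})$ converges if there is $p\in Q(\mathcal{C})$, $p\ne0$, such that all $a_n/p$ lie in $\mathcal{C}$ and converge uniformly on every finite interval; the limit is $p\lim_n(a_n/p)$, and it is unique. Series are limits of partial sums. $\mathbb{C}\{X\}$ is the ring of convergent power series (positive radius of convergence). For $\sum\alpha_nX^n\in\mathbb{C}\{X\}$ the series $\sum_{n=0}^\infty\alpha_nl^n$ ($l^0=1$, powers by convolution) converges in $Q(\mathcal{C})$, and $\mathbb{C}\{l\}=\{\sum_{n=0}^\infty\alpha_nl^n : \sum_{n=0}^\infty\alpha_nX^n\in\mathbb{C}\{X\}\}\subset Q(\mathcal{C})$; it is a subring isomorphic to $\mathbb{C}\{X\}$ via $l\leftrightarrow X$ (the coefficients are uniquely determined). The derivation $\frac{d}{ds}$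 of $Q(\mathcal{C})$ is the unique extension, by the quotient rule, of the map $\{a(t)\}\mapsto\{-t\,a(t)\}$ on $\mathcal{C}$. The automorphism $T^\alpha$ is extended from $\mathcal{C}$ to fractions by $T^\alpha(a/b)=T^\alpha a/T^\alpha b$; it fixes $\mathbb{C}$. A DT ring (field) is a ring (field) equipped with a derivation and a transforming operator (an injective endomorphism); a DT subring (subfield) is a subring (subfield) mapped into itself by both, with the restricted maps. *)

(* Defs.v *)
From HB Require Import structures.
From mathcomp Require Import all_boot all_order all_algebra.
From mathcomp Require Import all_classical all_reals all_analysis.
From mathcomp Require Import complex zify ring lra.
Set Implicit Arguments.
Unset Strict Implicit.
Unset Printing Implicit Defensive.
Import Order.TTheory GRing.Theory Num.Theory numFieldNormedType.Exports.
Local Open Scope classical_set_scope.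
Local Open Scope ring_scope.

Section LaurentDef.
Variable K : fieldType.

Definition bounded_below (f : int -> K) : Prop :=
  exists N : int, forall n, n < N -> f n = 0.

Definition laurent_pred : {pred int -> K} := [pred f | `[< bounded_below f >]].

Fact laurent_zmod : zmod_closed laurent_pred.
Proof.
split; first by apply/asboolP; exists 0.
move=> f g /asboolP[N fN] /asboolP[M gM]; apply/asboolP; exists (Num.min N M).
move=> n; rewrite lt_min => /andP[nN nM].
by rewrite -[LHS]/(f n - g n) fN// gM// subr0.
Qed.
HB.instance Definition _ :=
  GRing.isZmodClosed.Build (int -> K) laurent_pred laurent_zmod.

(* Formal Laurent series over K: [f n] is the coefficient of the n-th power of
   the indeterminate, and [f n = 0] for all sufficiently negative [n]. *)
Record laurent := Laurent { lcoef :> int -> K; lcoefP : lcoef \in laurent_pred }.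
HB.instance Definition _ := [isSub for lcoef].
HB.instance Definition _ := [Choice of laurent by <:].
HB.instance Definition _ := [SubChoice_isSubZmodule of laurent by <:].

Implicit Types f g h : laurent.

Lemma laurentE f g : (forall n, f n = g n) -> f = g.
Proof. by move=> fg; apply/val_inj/funext. Qed.

Lemma laurent_bounded f : exists N : int, forall n, n < N -> f n = 0.
Proof. by case: f => f /= /asboolP. Qed.

Lemma laurent_bounded_nat f : exists N : nat, forall n : int, n < - N%:Z -> f n = 0.
Proof.
have [N fN] := laurent_bounded f; exists (absz N) => n nN; apply: fN.
by apply: lt_le_trans nN _; lia.
Qed.

Definition lmul_fun f g : int -> K :=
  fun n => \sum_(i \in [set: int]) f i * g (n - i).

Definition box (B : nat) : seq int := [seq i%:Z - B%:Z | i <- iota 0 (B + B).+1].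
Lemma box_uniq B : uniq (box B).
Proof. by rewrite map_inj_uniq ?iota_uniq// => i j; lia. Qed.
Lemma mem_box B (i : int) : (i \in box B) = (- B%:Z <= i <= B%:Z).
Proof.
apply/mapP/idP => [[k]|/andP[i1 i2]].
  by rewrite mem_iota => ? ->; lia.
by exists (absz (i + B%:Z)); [rewrite mem_iota|]; lia.
Qed.

Lemma fsum_box B (F : int -> K) :
  (forall i, i \notin box B -> F i = 0) ->
  \sum_(i \in [set: int]) F i = \sum_(i <- box B) F i.
Proof.
move=> F0; rewrite (fsbigE (box B)) ?box_uniq//.
  by apply: eq_bigl => i; apply: mem_set.
by move=> i _; exact: F0.
Qed.

Fact lmul_fun_bounded f g : lmul_fun f g \in laurent_pred.
Proof.
have [N fN] := laurent_bounded f; have [M gM] := laurent_bounded g.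
apply/asboolP; exists (N + M) => n nNM; rewrite /lmul_fun fsbig1// => i _.
have [iN|iN] := ltP i N; first by rewrite fN ?mul0r.
by rewrite gM ?mulr0//; lia.
Qed.
Definition lmul f g := Laurent (lmul_fun_bounded f g).

Fact lconst_subproof (c : K) k : (fun n : int => if n == k then c else 0) \in laurent_pred.
Proof. by apply/asboolP; exists k => n nk; rewrite lt_eqF. Qed.
Definition lmono (c : K) (k : int) := Laurent (lconst_subproof c k).

Lemma lmulE f g n : lmul f g n = \sum_(i \in [set: int]) f i * g (n - i).
Proof. by []. Qed.

Lemma lmulC : commutative lmul.
Proof.
move=> f g; apply: laurentE => n; rewrite !lmulE.
rewrite (@reindex_fsbigT _ _ _ _ _ (fun i => n - i)).
  by apply: eq_fsbigr => i _; rewrite mulrC; congr (g _ * _); lia.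
by exists (fun i => n - i) => i; lia.
Qed.

Lemma lmulDl : left_distributive lmul +%R.
Proof.
move=> f f' g; apply: laurentE => n; rewrite -[RHS]/(lmul f g n + lmul f' g n) !lmulE.
have [N fN] := laurent_bounded_nat f; have [N' fN'] := laurent_bounded_nat f'.
have [M gM] := laurent_bounded_nat g.
have H B (F : laurent) i : (forall n : int, n < - B%:Z -> F n = 0) ->
    (B <= N + N' + M + absz n)%N ->
    i \notin box (N + N' + M + absz n) -> F i * g (n - i) = 0.
  rewrite mem_box => FB BB ib; have [iN|iN] := ltP i (- B%:Z); first by rewrite FB ?mul0r.
  by rewrite gM ?mulr0//; lia.
rewrite !(@fsum_box (N + N' + M + absz n)) ?big_split/=.
- rewrite -big_split/=; apply: eq_bigr => i _; rewrite -mulrDl //.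
- by move=> i; apply: (H N') => //; lia.
- by move=> i; apply: (H N) => //; lia.
- move=> i ib; rewrite -[X in X * _]/(f i + f' i) mulrDl (H N)// ?(H N') ?addr0//; lia.
Qed.

Lemma lmul1 : left_id (lmono 1 0) lmul.
Proof.
move=> f; apply: laurentE => n; rewrite lmulE (@fsum_box 0); last first.
  by move=> i; rewrite mem_box /= => i0; rewrite ifF ?mul0r//; lia.
by rewrite /box/= big_cons big_nil /= addr0 !subrr /= mul1r subr0.
Qed.

Lemma lmulA : associative lmul.
Proof.
move=> f g h; apply: laurentE => n; rewrite !lmulE.
have [N fN] := laurent_bounded_nat f; have [M gM] := laurent_bounded_nat g.
have [P hP] := laurent_bounded_nat h.
pose B := (N + M + P + absz n)%N.
have gh i : lmul g h (n - i) = \sum_(j \in [set: int]) g (j - i) * h (n - j).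
  rewrite lmulE (@reindex_fsbigT _ _ _ _ _ (fun j => j - i)).
    by apply: eq_fsbigr => j _; congr (_ * h _); lia.
  by exists (fun j => j + i) => j; lia.
under eq_fsbigr do rewrite gh mulr_fsumr.
under [RHS]eq_fsbigr do rewrite lmulE mulr_fsuml.
have F0 i j : i \notin box B \/ j \notin box B -> f i * (g (j - i) * h (n - j)) = 0.
  rewrite !mem_box /B => ij.
  have [iN|iN] := ltP i (- N%:Z); first by rewrite fN ?mul0r.
  have [jM|jM] := ltP (j - i) (- M%:Z); first by rewrite gM ?mul0r ?mulr0.
  have [jP|jP] := ltP (n - j) (- P%:Z); first by rewrite hP ?mulr0.
  by exfalso; lia.
rewrite (@fsum_box B); last first.
  by move=> i ib; rewrite fsbig1// => j _; apply: F0; left.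
rewrite (eq_bigr (fun i => \sum_(j <- box B) f i * (g (j - i) * h (n - j)))).
  2: by move=> i _; rewrite (@fsum_box B)// => j jb; apply: F0; right.
rewrite exchange_big/= (@fsum_box B); last first.
  by move=> j jb; rewrite fsbig1// => i _; rewrite -mulrA; apply: F0; right.
apply: eq_bigr => j _; rewrite (@fsum_box B).
  by apply: eq_bigr => i _; rewrite mulrA.
by move=> i ib; rewrite -mulrA; apply: F0; left.
Qed.

Lemma lmono1_neq0 : lmono 1 0 != 0.
Proof.
apply/eqP => /(congr1 (fun f : laurent => f 0)) /= /eqP.
by rewrite -[X in _ == X]/(0 : K) oner_eq0.
Qed.
HB.instance Definition _ := GRing.Zmodule_isComNzRing.Build laurent
  lmulA lmulC lmul1 lmulDl lmono1_neq0.

Lemma coefLM f g n : (f * g) n = \sum_(i \in [set: int]) f i * g (n - i).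
Proof. by []. Qed.

Lemma coefL1 n : (1 : laurent) n = if n == 0 then 1 else 0.
Proof. by []. Qed.

Lemma laurent_order f : f != 0 ->
  exists v : int, f v != 0 /\ forall n, n < v -> f n = 0.
Proof.
move=> f0; have [N fN] := laurent_bounded_nat f.
have [k fk] : exists k : nat, f (k%:Z - N%:Z) != 0.
  apply: contrapT => H; move/eqP: f0; apply; apply: laurentE => n.
  have [/fN//|nN] := ltP n (- N%:Z).
  apply/eqP/negP => /negP fn; apply: H; exists (absz (n + N%:Z)).
  by rewrite (_ : _ - _ = n)//; lia.
have := ex_minnP (ex_intro (fun k : nat => f (k%:Z - N%:Z) != 0) k fk).
case=> v fv vmin; exists (v%:Z - N%:Z); split=> // n nv.
have [/fN//|nN] := ltP n (- N%:Z).
apply/eqP/negP => /negP fn.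
have /vmin : f ((absz (n + N%:Z))%:Z - N%:Z) != 0.
  by rewrite (_ : _ - _ = n)//; lia.
lia.
Qed.

Fixpoint inv_seq (u : nat -> K) (n : nat) : seq K :=
  if n is m.+1 then
    let s := inv_seq u m in
    rcons s (- (u 0%N)^-1 * \sum_(k < m.+1) s`_k * u (m.+1 - k)%N)
  else [:: (u 0%N)^-1].

Lemma size_inv_seq u n : size (inv_seq u n) = n.+1.
Proof. by elim: n => //= n IH; rewrite size_rcons IH. Qed.

Lemma nth_inv_seq u n m : (m <= n)%N -> (inv_seq u n)`_m = (inv_seq u m)`_m.
Proof.
elim: n => [|n IH]; first by case: m.
rewrite leq_eqVlt => /orP[/eqP->//|]; rewrite ltnS => mn.
by rewrite /= nth_rcons size_inv_seq ltnS mn IH.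
Qed.

Definition inv_coef u n := (inv_seq u n)`_n.

Lemma inv_coefP u n : u 0%N != 0 ->
  \sum_(k < n.+1) inv_coef u k * u (n - k)%N = if n == 0%N then 1 else 0.
Proof.
move=> u0; case: n => [|n].
  by rewrite big_ord_recr big_ord0 /= add0r mulVf.
rewrite big_ord_recr /= {2}/inv_coef /= nth_rcons size_inv_seq ltnn eqxx subnn.
rewrite mulrAC mulNr mulVf// mulN1r.
apply/eqP; rewrite subr_eq0; apply/eqP; apply: eq_bigr => k _.
by rewrite nth_inv_seq// -ltnS ltn_ord.
Qed.

Lemma laurent_inv_ex f : f != 0 -> exists g, g * f = 1.
Proof.
move=> /laurent_order[v [fv fmin]].
pose u (n : nat) := f (v + n%:Z).
pose gf (n : int) := if n < - v then 0 else inv_coef u (absz (n + v)).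
have gP : gf \in laurent_pred.
  by apply/asboolP; exists (- v) => n nv; rewrite /gf nv.
exists (Laurent gP); apply: laurentE => n; rewrite coefLM coefL1 /=.
have [n0|n0] := ltP n 0.
  rewrite fsbig1 => [|i _]; first by rewrite ifF//; lia.
  rewrite /gf; case: ltP => iv; first by rewrite mul0r.
  by rewrite fmin ?mulr0//; lia.
have -> : (if n == 0 then 1 else 0 : K) = if absz n == 0%N then 1 else 0.
  by congr (if _ then _ else _); lia.
rewrite -(@inv_coefP u) ?/u ?addr0//.
rewrite (fsbigE [seq k%:Z - v | k <- iota 0 (absz n).+1])//; last 2 first.
- by rewrite map_inj_uniq ?iota_uniq// => i j; lia.
- move=> i _ iN; rewrite /gf; case: ltP => iv; first by rewrite mul0r.
  rewrite fmin ?mulr0//; apply: contraNT iN => iN; apply/mapP.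
  by exists (absz (i + v)); [rewrite mem_iota|]; lia.
rewrite big_map (eq_bigl xpredT); last by move=> i; apply: mem_set.
rewrite -[iota _ _]/(index_iota 0 (absz n).+1) big_mkord; apply: eq_bigr => k _.
rewrite /gf ifF; last by lia.
congr (inv_coef _ _ * f _); last first.
  have := ltn_ord k; lia.
lia.
Qed.

Definition linv f : laurent := xget 0 [set g | g * f = 1].

Lemma linvP f : f != 0 -> linv f * f = 1.
Proof. by move=> /laurent_inv_ex[g gf]; apply: (@xgetPex _ 0 [set g | g * f = 1]); exists g. Qed.

Lemma linv0 : linv 0 = 0.
Proof.
rewrite /linv; case: xgetP => // g _ /=; rewrite mulr0 => /esym/eqP.
by rewrite oner_eq0.
Qed.
HB.instance Definition _ := GRing.ComNzRing_isField.Build laurent linvP linv0.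

Definition lX : laurent := lmono 1 1.
Definition lconst (c : K) : laurent := lmono c 0.

(* The series l / (1 - alpha l). *)
Definition lmob (alpha : K) : laurent := lX / (1 - lconst alpha * lX).

Lemma vanish_mul f g (a b : int) : (forall n, n < a -> f n = 0) ->
  (forall n, n < b -> g n = 0) -> forall n, n < a + b -> (f * g) n = 0.
Proof.
move=> fa gb n nab; rewrite coefLM fsbig1// => i _.
have [/fa ->|ia] := ltP i a; first by rewrite mul0r.
by rewrite gb ?mulr0//; lia.
Qed.

Lemma vanish_exp f (a : int) : (forall n, n < a -> f n = 0) ->
  forall (k : nat) n, n < a * k%:Z -> (f ^+ k) n = 0.
Proof.
move=> fa; elim=> [|k IH] n; first by rewrite mulr0 expr0 coefL1 => n0; rewrite lt_eqF.
by rewrite exprS => nk; apply: (vanish_mul fa IH); lia.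
Qed.

Lemma coefLXM f n : (lX * f) n = f (n - 1).
Proof.
rewrite coefLM (fsbigE [:: 1])//=.
  by rewrite big_cons big_nil mem_set//= mul1r addr0.
by move=> i _; rewrite inE => /negbTE ->; rewrite mul0r.
Qed.

Lemma coefLCM c f n : (lconst c * f) n = c * f n.
Proof.
rewrite coefLM (fsbigE [:: 0])//=.
  by rewrite big_cons big_nil mem_set//= subr0 addr0.
by move=> i _; rewrite inE => /negbTE ->; rewrite mul0r.
Qed.

Lemma coefL_sub alpha n : (1 - lconst alpha * lX) n =
  (if n == 0 then 1 else 0) - (if n == 1 then alpha else 0).
Proof.
rewrite -[LHS]/((1 : laurent) n - (lconst alpha * lX) n) coefLCM coefL1 /=.
by case: (n == 1); rewrite ?mulr1 ?mulr0.
Qed.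

Lemma vanish_inv f : f 0 != 0 -> (forall n, n < 0 -> f n = 0) ->
  forall n, n < 0 -> (f^-1) n = 0.
Proof.
move=> f0 fn; have fN0 : f != 0 by apply: contraNneq f0 => ->.
have : f^-1 != 0 by rewrite invr_eq0.
move=> /laurent_order[v [gv gmin]] n n0; apply: (gmin n).
apply: lt_le_trans n0 _; rewrite leNgt; apply/negP => v0.
have : (f^-1 * f) v = 0 by rewrite mulVf// coefL1 ifF//; lia.
rewrite coefLM (fsbigE [:: v])//=; last first.
  move=> i _; rewrite inE => iv; have [/gmin ->|vi] := ltP i v; first by rewrite mul0r.
  by rewrite fn ?mulr0//; lia.
rewrite big_cons big_nil mem_set//= subrr addr0 => /eqP.
by rewrite mulf_eq0 (negbTE gv) (negbTE f0).
Qed.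

Lemma vanish_lmob alpha (k n : int) : n < k -> (lmob alpha ^ k) n = 0.
Proof.
have u0 : (1 - lconst alpha * lX) 0 != 0 by rewrite coefL_sub /= subr0 oner_neq0.
have un n' : n' < 0 -> (1 - lconst alpha * lX) n' = 0.
  by move=> n0; rewrite coefL_sub !ifF ?subr0//; lia.
have w1 n' : n' < 1 -> lmob alpha n' = 0.
  by move=> n1; rewrite coefLXM (vanish_inv u0 un)//; lia.
have [X Xn] : exists X : laurent, X = (lmob alpha)^-1 /\ forall n', n' < -1 -> X n' = 0.
  exists ((1 - lconst alpha * lX) * lmono 1 (-1)); split.
    rewrite /lmob invf_div; congr (_ * _).
    have -> : lmono 1 (-1) = lX^-1; last by [].
    have XX : lX * lmono 1 (-1) = 1.
      by apply: laurentE => m; rewrite coefLXM coefL1 /=; congr (if _ then _ else _); lia.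
    have X0 : lX != 0 by apply: contra_eq_neq XX => ->; rewrite mul0r eq_sym oner_neq0.
    by apply: (mulfI X0); rewrite XX divff.
  move=> m m1; rewrite -[-1]add0r in m1; apply: (vanish_mul un _ m1) => p p1 /=.
  by rewrite ifF//; lia.
case: k => k nk; first by rewrite -exprnP (vanish_exp w1)//; lia.
case: Xn => Xe Xv.
by rewrite NegzE -exprnN -exprVn -Xe (vanish_exp Xv)//; lia.
Qed.

(* The substitution l |-> l / (1 - alpha l): the coefficient of l ^ m in
   sum_n f_n (l / (1 - alpha l)) ^ n. The sum is finite because the m-th
   coefficient of the n-th power vanishes for n > m (vanish_lmob). *)
Fact lsubst_subproof (alpha : K) f :
  (fun m => \sum_(n \in [set: int]) f n * (lmob alpha ^ n) m) \in laurent_pred.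
Proof.
have [N fN] := laurent_bounded f.
apply/asboolP; exists N => m mN; rewrite fsbig1// => n _.
have [nm|mn] := ltP m n; first by rewrite vanish_lmob ?mulr0.
by rewrite fN ?mul0r//; lia.
Qed.
Definition lsubst alpha f := Laurent (lsubst_subproof alpha f).

(* sum_n f_n l ^ n |-> sum_n - n f_n l ^ (n + 1). *)
Fact lder_subproof f : (fun n : int => - (n - 1)%:~R * f (n - 1)) \in laurent_pred.
Proof.
have [N fN] := laurent_bounded f.
by apply/asboolP; exists N => m mN; rewrite fN ?mulr0//; lia.
Qed.
Definition lder f := Laurent (lder_subproof f).

Fact lseries_subproof (a : nat -> K) :
  (fun n : int => if n is Posz k then a k else 0) \in laurent_pred.
Proof. by apply/asboolP; exists 0 => -[]. Qed.
Definition lseries a := Laurent (lseries_subproof a).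
End LaurentDef.

Section RealConv.
Variable R : realType.
Local Notation mu := (@lebesgue_measure R).

Lemma cont_integrable (f : R -> R) (s t : R) :
  continuous f -> mu.-integrable `[s, t] (EFin \o f).
Proof.
move=> cf; apply: continuous_compact_integrable; first exact: segment_compact.
exact: continuous_subspaceT.
Qed.

Lemma cont_bounded (f : R -> R) (s t : R) : continuous f ->
  exists M, forall x, s <= x <= t -> `|f x| <= M.
Proof.
move=> cf.
have [M [_ HM]] : bounded_set (f @` `[s, t]).
  by apply/compact_bounded/continuous_compact; [exact: continuous_subspaceT|exact: segment_compact].
exists (M + 1) => x xst; apply: (HM (M + 1)); first by rewrite ltrDl.
by exists x => //=; rewrite in_itv.
Qed.

Lemma prim_continuous (b : R -> R) : continuous b ->
  continuous (fun t : R => \int[mu]_(u in `[0, t]) b u : R).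
Proof.
move=> cb t0; pose P (t : R) : R := \int[mu]_(u in `[0, t]) b u; change (P x @[x --> t0] --> P t0).
pose T := `|t0| + 1.
have T0 : 0 <= T by rewrite /T addr_ge0.
have P0 t : t <= 0 -> P t = 0.
  move=> t_le0; rewrite /P; have [->|tn0] := eqVneq t 0.
    by rewrite set_itv1 Rintegral_set1.
  by rewrite set_itv_ge ?Rintegral_set0// bnd_simp -ltNge lt_neqAle tn0.
have c1 : {within `]-oo, (0:R)], continuous P}.
  apply: (@subspace_eq_continuous _ _ _ (fun=> 0 : R)) => [x|].
    rewrite inE/= in_itv/= => x0; exact/esym/P0.
  by apply: continuous_subspaceT => x; exact: cst_continuous.
have c2 : {within `[0, T], continuous P}.
  by apply: parameterized_integral_continuous => //; exact: cont_integrable.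
have c3 : {within `]-oo, (0:R)] `|` `[0, T], continuous P}.
  by apply: withinU_continuous => //; exact: interval_closed.
have t0T : t0 \in `]-oo, T[%classic.
  by rewrite inE/= in_itv/= /T (le_lt_trans (ler_norm _))// ltrDl.
have c4 : {within `]-oo, T[, continuous P}.
  apply: continuous_subspaceW (c3).
  move=> x /=; rewrite !in_itv/= => xT; case: (leP x 0) => x0; [left|right] => //=.
  by rewrite (ltW x0) ltW.
by move: c4; rewrite continuous_open_subspace; [exact|exact: interval_open].
Qed.

Lemma rconv_continuous (a b : R -> R) : continuous a -> continuous b ->
  (forall t, t < 0 -> a t = a 0) ->
  continuous (fun t : R => \int[mu]_(u in `[0, t]) (a (t - u) * b u) : R).
Proof.
move=> ca cb a0 t0; pose T := `|t0| + 1.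
have T0 : 0 <= T by rewrite /T addr_ge0.
have t0T : t0 \in `]- T, T[%classic.
  rewrite inE/= in_itv/= /T; apply/andP; split.
    by rewrite ltrNl -normrN (le_lt_trans (ler_norm _))// ltrDl.
  by rewrite (le_lt_trans (ler_norm _))// ltrDl.
pose a1 t := a t - a 0.
have a1N t : t <= 0 -> a1 t = 0.
  rewrite le_eqVlt => /predU1P[->|/a0]; rewrite /a1 ?subrr// => ->.
  by rewrite subrr.
have ca1 : continuous a1 by move=> x; apply: cvgB; [exact: ca|exact: cvg_cst].
have cta1 t : continuous (fun u => a1 (t - u) * b u).
  move=> x; apply: cvgM; last exact: cb.
  apply: (@continuous_comp _ _ _ (fun u => t - u) a1); last exact: ca1.
  by apply: cvgB; [exact: cvg_cst|exact: cvg_id].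
pose F t : R := \int[mu]_(u in `[0, T]) (a1 (t - u) * b u).
pose P t : R := \int[mu]_(u in `[0, t]) b u.
have split t : t < T ->
    \int[mu]_(u in `[0, t]) (a (t - u) * b u) = F t + a 0 * P t.
  move=> tT.
  have -> : F t = \int[mu]_(u in `[0, t]) (a1 (t - u) * b u).
    rewrite /F Rintegral_mkcond [RHS]Rintegral_mkcond; congr Rintegral.
    apply/funext => u; rewrite !patchE !mem_setE !in_itv/=.
    case: (leP 0 u) => //= u0; case: (leP u t) => ut.
      by rewrite (le_trans ut (ltW tT)).
    by rewrite a1N ?mul0r ?if_same// subr_le0 ltW.
  rewrite /P -RintegralZl//; last exact: cont_integrable.
  rewrite -RintegralD//; last 2 first.
  - exact: cont_integrable.
  - by apply: cont_integrable => x; apply: cvgM; [exact: cvg_cst|exact: cb].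
  by apply: eq_Rintegral => u _; rewrite /a1; ring.
have cF : {in `]- T, T[%classic, continuous F}.
  have [M MP] := cont_bounded (- T - T) T ca1.
  have [N NP] := cont_bounded 0 T cb.
  apply: (@continuity_under_integral _ _ _ mu _ _ _ (- T) T _ _ (fun=> M * N)) => //.
  - by move=> x _; exact: cont_integrable.
  - apply: aeW => y /= _ x _; apply: cvgM; last exact: cvg_cst.
    apply: (@continuous_comp _ _ _ (fun t => t - y) a1); last exact: ca1.
    by apply: cvgB; [exact: cvg_id|exact: cvg_cst].
  - by apply: cont_integrable; exact: cst_continuous.
  - move=> x /=; rewrite in_itv/= => /andP[x1 x2]; apply: aeW => y /=.
    rewrite in_itv/= => /andP[y1 y2]; rewrite normrM ler_pM//.
      by apply: MP; apply/andP; split; lra.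
    by apply: NP; rewrite y1.
have lim : F t + a 0 * P t @[t --> t0] --> F t0 + a 0 * P t0.
  apply: cvgD; first exact: cF.
  by apply: cvgM; [exact: cvg_cst|exact: prim_continuous].
have tT : t0 < T by move: t0T; rewrite inE/= in_itv/= => /andP[].
rewrite -(split _ tT) in lim; apply: cvg_trans lim; apply: near_eq_cvg.
near=> t; rewrite -split//; near: t.
exact: lt_nbhsl.
Unshelve. all: by end_near. Qed.
End RealConv.

Section HalfLine.
Variable R : realType.
Local Notation mu := (@lebesgue_measure R).

Lemma Re_continuous : continuous (@complex.Re R : R[i]^o -> R).
Proof.
move=> z; apply/(@cvgrPdist_lt _ _ _ (nbhs (z : R[i]^o)) (nbhs_filter _)) => e e0.
have : \forall t \near (z : R[i]^o), `|z - t| < e%:C%C.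
  by exists e%:C%C => //=; rewrite ltcR.
apply: (@filterS _ (nbhs (z : R[i]^o)) (nbhs_filter _)) => t; rewrite normc_def -raddfB/= ltcR; apply: le_lt_trans.
by rewrite -sqrtr_sqr ler_wsqrtr// lerDl sqr_ge0.
Qed.

Lemma Im_continuous : continuous (@complex.Im R : R[i]^o -> R).
Proof.
move=> z; apply/(@cvgrPdist_lt _ _ _ (nbhs (z : R[i]^o)) (nbhs_filter _)) => e e0.
have : \forall t \near (z : R[i]^o), `|z - t| < e%:C%C.
  by exists e%:C%C => //=; rewrite ltcR.
apply: (@filterS _ (nbhs (z : R[i]^o)) (nbhs_filter _)) => t; rewrite normc_def -raddfB/= ltcR; apply: le_lt_trans.
by rewrite -sqrtr_sqr ler_wsqrtr// lerDr sqr_ge0.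
Qed.

Lemma complex_cvg (T : Type) (F : set_system T) {FF : Filter F} (f g : T -> R) (a b : R) :
  f @ F --> a -> g @ F --> b ->
  (fun t => (f t +i* g t)%C : R[i]^o) @ F --> ((a +i* b)%C : R[i]^o).
Proof.
move=> fa gb; apply/cvgrPdist_lt => e; rewrite ltcE/= => /andP[/eqP ie e0].
have e2 : 0 < complex.Re e / 2 by rewrite divr_gt0.
have fa' := (cvgrPdist_lt f a).1 fa _ e2; have gb' := (cvgrPdist_lt g b).1 gb _ e2.
have -> : e = (complex.Re e)%:C%C by case: e ie {e0 e2 fa' gb'} => ? ? /= ->.
near=> t.
rewrite (_ : _ - _ = ((a - f t)%:C + 'i * (b - g t)%:C)%C :> R[i]); last first.
  by simpc.
apply: (le_lt_trans (ler_normD _ _)).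
have n1 (x : R) : `|x%:C%C| = (`|x|)%:C%C :> R[i].
  by rewrite normc_def /= expr0n /= addr0 sqrtr_sqr.
have -> : `|('i * (b - g t)%:C)%C| = (`|b - g t|)%:C%C :> R[i].
  by rewrite normrM n1 normc_def /= expr0n /= add0r expr1n sqrtr1 mul1r.
rewrite n1 -raddfD/= ltcR (splitr (complex.Re e)); apply: ltrD; near: t.
  exact: fa'.
exact: gb'.
Unshelve. all: by end_near.
Qed.

Lemma complex_continuous (f g : R -> R) : continuous f -> continuous g ->
  continuous (fun t => (f t +i* g t)%C : R[i]^o).
Proof. by move=> cf cg t; apply: complex_cvg; [exact: cf|exact: cg]. Qed.

(* A continuous function on [0, +oo) is represented by its continuous extension
   to the whole line that is constant on the negative half-line. This extension
   is unique ([Cplus_ext]) and always exists ([of_cont]), so [Cplus] is in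
   bijection with the continuous complex-valued functions on [0, +oo). *)
Definition cplus_pred : {pred R -> R[i]} :=
  [pred f | `[< continuous (f : R -> R[i]^o) /\ forall t, t < 0 -> f t = f 0 >]].

Fact cplus_zmod : zmod_closed cplus_pred.
Proof.
split; first by apply/asboolP; split => // x; exact: cvg_cst.
move=> f g /asboolP[cf f0] /asboolP[cg g0]; apply/asboolP; split.
  by move=> x; apply: (@cvgB R[i] R[i]^o); [exact: cf|exact: cg].
by move=> t t0; rewrite -[LHS]/(f t - g t) f0// g0.
Qed.
HB.instance Definition _ :=
  GRing.isZmodClosed.Build (R -> R[i]) cplus_pred cplus_zmod.

Record Cplus := MkCplus { Cplus_val :> R -> R[i]; CplusP : Cplus_val \in cplus_pred }.
HB.instance Definition _ := [isSub for Cplus_val].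
HB.instance Definition _ := [Choice of Cplus by <:].
HB.instance Definition _ := [SubChoice_isSubZmodule of Cplus by <:].

Implicit Types f g : Cplus.

Lemma Cplus_continuous f : continuous (f : R -> R[i]^o).
Proof. by case: f => f /= /asboolP[]. Qed.

Lemma Cplus_neg f t : t < 0 -> f t = f 0.
Proof. by case: f => f /= /asboolP[_]; apply. Qed.

Lemma Cplus_ext f g : (forall t, 0 <= t -> f t = g t) -> f = g.
Proof.
move=> fg; apply/val_inj/funext => t /=.
by have [/fg//|t0] := leP 0 t; rewrite !Cplus_neg ?fg.
Qed.

Fact of_cont_subproof (f : R -> R[i]) :
  {within `[0, +oo[, continuous (f : R -> R[i]^o)} ->
  (fun t => f (Num.max 0 t)) \in cplus_pred.
Proof.
move=> cf; apply/asboolP; split; last first.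
  by move=> t t0; rewrite max_l ?ltW// maxxx.
have cf' := (subspace_continuousP _ _).1 cf.
move=> t; have m0 : `[0, +oo[%classic (Num.max 0 t) by rewrite /= in_itv/= andbT le_max lexx.
apply: (@cvg_comp _ _ _ (Num.max 0) f _ (within `[0, +oo[ (nbhs (Num.max 0 t)))); last exact: cf'.
have cm : Num.max 0 u @[u --> t] --> Num.max 0 t.
  by apply: (@continuous_max _ _ (fun=> 0) id); [exact: cvg_cst|exact: cvg_id].
move=> A /cm H; apply: (@filterS _ (nbhs t) (nbhs_filter _) _ _ _ H) => u; apply.
by rewrite /= in_itv/= andbT le_max lexx.
Qed.

Definition of_cont (f : R -> R[i]) (cf : {within `[0, +oo[, continuous (f : R -> R[i]^o)}) : Cplus :=
  MkCplus (of_cont_subproof cf).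

Lemma of_contE f cf t : 0 <= t -> @of_cont f cf t = f t.
Proof. by move=> t0 /=; rewrite max_r. Qed.

Lemma mul_continuous (f g : R -> R[i]^o) : continuous f -> continuous g ->
  continuous (fun t => f t * g t : R[i]^o).
Proof. by move=> cf cg t; apply: (@cvgM R[i]); [exact: cf|exact: cg]. Qed.

Fact Ccst_subproof (c : R[i]) : {within `[0, +oo[, continuous ((fun _ : R => c) : R -> R[i]^o)}.
Proof. by apply: continuous_subspaceT => t; exact: cvg_cst. Qed.
Definition Ccst c := of_cont (@Ccst_subproof c).

(* The integral of a complex function is computed on real and imaginary parts. *)
Definition conv_fun f g (t : R) : R[i] :=
  ((\int[mu]_(u in `[0, t]) complex.Re (f (t - u)%R * g u)%R) +i*
   (\int[mu]_(u in `[0, t]) complex.Im (f (t - u)%R * g u)%R))%C.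

Fact conv_subproof f g : conv_fun f g \in cplus_pred.
Proof.
apply/asboolP; split; last first.
  move=> t t0; rewrite /conv_fun set_itv1 !Rintegral_set1.
  by rewrite set_itv_ge ?Rintegral_set0// bnd_simp -ltNge.
have cRe (h : Cplus) : continuous (fun t => complex.Re (h t)).
  by move=> t; apply: (@continuous_comp _ _ _ (h : R -> R[i]^o) (@complex.Re R : R[i]^o -> R)); [exact: Cplus_continuous|exact: Re_continuous].
have cIm (h : Cplus) : continuous (fun t => complex.Im (h t)).
  by move=> t; apply: (@continuous_comp _ _ _ (h : R -> R[i]^o) (@complex.Im R : R[i]^o -> R)); [exact: Cplus_continuous|exact: Im_continuous].
have rc := @rconv_continuous R.
have ci (a b : R -> R) t s : continuous a -> continuous b ->
    mu.-integrable `[0, s] (EFin \o (fun u => a (t - u) * b u)).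
  move=> ca cb; apply: cont_integrable => x; apply: cvgM; last exact: cb.
  apply: (@continuous_comp _ _ _ (fun u => t - u) a); last exact: ca.
  by apply: cvgB; [exact: cvg_cst|exact: cvg_id].
apply: complex_continuous.
- rewrite (_ : (fun _ => _) = (fun t : R =>
    \int[mu]_(u in `[0, t]) (complex.Re (f (t - u)) * complex.Re (g u)) -
    \int[mu]_(u in `[0, t]) (complex.Im (f (t - u)) * complex.Im (g u)))).
    move=> t; apply: cvgB.
      by apply: (rc (fun s => complex.Re (f s))) => // s s0; rewrite Cplus_neg.
    by apply: (rc (fun s => complex.Im (f s))) => // s s0; rewrite Cplus_neg.
  apply/funext => t; rewrite -RintegralB//.
  + by apply: eq_Rintegral => u _; case: (f _) (g u) => ? ? [].
  + exact: (ci (fun s => complex.Re (f s))).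
  + exact: (ci (fun s => complex.Im (f s))).
- rewrite (_ : (fun _ => _) = (fun t : R =>
    \int[mu]_(u in `[0, t]) (complex.Re (f (t - u)) * complex.Im (g u)) +
    \int[mu]_(u in `[0, t]) (complex.Im (f (t - u)) * complex.Re (g u)))).
    move=> t; apply: cvgD.
      by apply: (rc (fun s => complex.Re (f s))) => // s s0; rewrite Cplus_neg.
    by apply: (rc (fun s => complex.Im (f s))) => // s s0; rewrite Cplus_neg.
  apply/funext => t; rewrite -RintegralD//.
  + by apply: eq_Rintegral => u _; case: (f _) (g u) => ? ? [].
  + exact: (ci (fun s => complex.Re (f s))).
  + exact: (ci (fun s => complex.Im (f s))).
Qed.
Definition conv f g : Cplus := MkCplus (conv_subproof f g).

Definition cexp (z : R[i]) : R[i] :=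
  ((expR (complex.Re z))%:C * (cos (complex.Im z) +i* sin (complex.Im z)))%C.

Fact Ctwist_subproof alpha f :
  {within `[0, +oo[, continuous ((fun t : R => cexp (alpha * t%:C%C) * f t) : R -> R[i]^o)}.
Proof.
apply: continuous_subspaceT; apply: mul_continuous; last exact: Cplus_continuous.
case: alpha => a b.
have cm (c : R) : continuous (fun t => c * t).
  by move=> x; apply: cvgM; [exact: cvg_cst|exact: cvg_id].
have -> : (fun t : R => cexp ((a +i* b)%C * t%:C%C)) =
   (fun t => (expR (a * t) * cos (b * t) +i* (expR (a * t) * sin (b * t)))%C).
  by apply/funext => t; rewrite (_ : (a +i* b)%C * t%:C%C = (a * t +i* (b * t))%C) /cexp /=; simpc.
apply: complex_continuous => t; apply: cvgM.
- by apply: (@continuous_comp _ _ _ _ expR); [exact: cm|exact: continuous_expR].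
- by apply: (@continuous_comp _ _ _ _ cos); [exact: cm|exact: continuous_cos].
- by apply: (@continuous_comp _ _ _ _ expR); [exact: cm|exact: continuous_expR].
- by apply: (@continuous_comp _ _ _ _ sin); [exact: cm|exact: continuous_sin].
Qed.
Definition Ctwist alpha f := of_cont (@Ctwist_subproof alpha f).

Fact Cder_subproof f :
  {within `[0, +oo[, continuous ((fun t : R => - t%:C%C * f t) : R -> R[i]^o)}.
Proof.
apply: continuous_subspaceT; apply: mul_continuous; last exact: Cplus_continuous.
move=> t; apply: (@cvgN R[i] R[i]^o).
by apply: complex_cvg; [exact: cvg_id|exact: cvg_cst].
Qed.
Definition Cder f := of_cont (@Cder_subproof f).
End HalfLine.

Section ConvergentSeries.
Variable R : realType.

Definition sums_to (u : nat -> R[i]) (x : R[i]) : Prop :=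
  series (u : nat -> R[i]^o) @ \oo --> (x : R[i]^o).

Definition convergent_series (a : nat -> R[i]) : Prop :=
  exists2 r : R, 0 < r & forall z : R[i], `|z| < r%:C%C ->
    exists x, sums_to (fun n => a n * z ^+ n) x.

(* The germ identity sum_n b_n Z^n = sum_n a_n (Z / (1 - alpha Z))^n at Z = 0. *)
Definition subst_germ (alpha : R[i]) (a b : nat -> R[i]) : Prop :=
  exists2 r : R, 0 < r & forall z : R[i], `|z| < r%:C%C ->
    exists x, sums_to (fun n => b n * z ^+ n) x /\
              sums_to (fun n => a n * (z / (1 - alpha * z)) ^+ n) x.
End ConvergentSeries.

Section DT.
Variable A : nzRingType.
Variables D T : A -> A.

Definition is_derivation : Prop :=
  {morph D : x y / x + y} /\ forall x y, D (x * y) = D x * y + x * D y.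

Definition is_transforming : Prop :=
  [/\ zmod_morphism T, monoid_morphism T & injective T].

Definition is_DT : Prop := is_derivation /\ is_transforming.

Definition DT_stable (S : set A) : Prop :=
  (forall x, S x -> S (D x)) /\ (forall x, S x -> S (T x)).

Definition DT_subring (S : set A) : Prop :=
  subring_closed [in S] /\ DT_stable S.
End DT.

Definition DT_subfield (F : fieldType) (D T : F -> F) (S : set F) : Prop :=
  divring_closed [in S] /\ DT_stable D T S.

Section FractionField.
Variables (R : realType) (Q : fieldType) (iota : Cplus R -> Q).

(* [Q], with the embedding [iota], is a field of fractions of the ring without
   identity [(Cplus R, +, conv)]; any two of them are canonically isomorphic,
   and one exists by Titchmarsh's theorem. *)
Definition is_fraction_field : Prop :=
  [/\ {morph iota : f g / f + g},
      {morph iota : f g / conv f g >-> f * g},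
      injective iota
    & forall q, exists f g, g != 0 /\ q = iota f / iota g].

Definition ell : Q := iota (Ccst 1).
Definition Qcst (c : R[i]) : Q := iota (Ccst c) / iota (Ccst 1).

Definition Qlim (u : nat -> Q) (x : Q) : Prop :=
  exists (p : Q) (g : nat -> Cplus R) (h : Cplus R),
    [/\ p != 0,
        forall n, u n / p = iota (g n),
        forall t : R,
          {uniform `[0, t], (fun n => g n : R -> R[i]^o) @ \oo --> (h : R -> R[i]^o)}
      & x = p * iota h].

Definition Qsums_to (m : nat) (u : nat -> Q) (x : Q) : Prop :=
  Qlim (fun n => \sum_(m <= k < n) u k) x.

(* A representation of [q] as a fraction, used to extend [Ctwist] and [Cder]
   to [Q]; the values of the extensions do not depend on the choice. *)
Definition frac_repr (q : Q) : Cplus R * Cplus R :=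
  xget (0, 0) [set fg | fg.2 != 0 /\ q = iota fg.1 / iota fg.2].

Definition twist (alpha : R[i]) (q : Q) : Q :=
  let: (f, g) := frac_repr q in iota (Ctwist alpha f) / iota (Ctwist alpha g).

Definition dds (q : Q) : Q :=
  let: (f, g) := frac_repr q in
  (iota (Cder f) * iota g - iota f * iota (Cder g)) / iota g ^+ 2.

Definition Cl : set Q := [set x | exists2 a, convergent_series a &
  Qsums_to 0 (fun n => Qcst (a n) * ell ^+ n) x].

Definition QCl : set Q :=
  [set x | exists y z, [/\ Cl y, Cl z, z != 0 & x = y / z]].
End FractionField.

(* Main.v *)
Require Import Defs.
From mathcomp Require Import all_boot all_order all_algebra.
From mathcomp Require Import all_classical all_reals all_analysis.
From mathcomp Require Import complex.
From mathcomp Require Import zify ring lra.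
Set Implicit Arguments.
Unset Strict Implicit.
Unset Printing Implicit Defensive.
Import Order.TTheory GRing.Theory Num.Theory numFieldNormedType.Exports.
Local Open Scope classical_set_scope.
Local Open Scope ring_scope.

(* A convergent series [sum_n a_n l^n] equals [s f], where [f t] is the entire
   function [sum_n a_n t^n / n!]. Each identity about such sums (product, image
   under [T^alpha]) and the identity of germs
   [sum_n b_n Z^n = sum_n a_n (Z / (1 - alpha Z))^n] is obtained in the same
   way. Splitting off the constant term, both sides satisfy the same recursion
   [X(a) = a_0 + theta X(a')] with [a'] the shifted sequence, so their
   difference [E] satisfies [E(a) = theta^n E(a^(n))] for all [n]. As
   [|a_k| <= C M^k] gives [E(a^(n)) = O(M^n)], while convolution with [l^n] is
   [O(t^n / n!)] (respectively [M |theta| <= 1/2]), [E] vanishes. *)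

(** Elements of [Q] have no size, so a defect there is first multiplied by [l ^ 2] (for products) or
    by [l * T l] (for [T^alpha]). It then becomes the image of a function, which can be estimated
    and shown to vanish, and the factor is cancelled. For [T^alpha] the recursion has [theta = T l];
    applying [T^(-alpha)] to the defect turns convolution with [e^(alpha t)] into convolution with
    1. The sequences [mobius] and [cauchy_prod] are built by the same head-and-tail recursion, so
    one sequence describes the operation in [Q], on formal Laurent series and on germs, and no
    double series is rearranged in [Q]. On Laurent series the recursion alone fixes the
    coefficients, one degree at a time. The embedding sends [S a / S b] to [lseries a / lseries b].
    It is well defined because [S] is injective and both sides multiply by the same [cauchy_prod];
    it respects the operators because these agree on series and are determined on quotients by the
    quotient rule and by multiplicativity. *)

(** * A real-valued norm on [R[i]] and dominated complex series *)

Section ComplexSums.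
Variable R : realType.
Implicit Types (z w : R[i]) (u : nat -> R[i]) (v : nat -> R).

(** The modulus of [R[i]] takes its values in [R[i]]; this l1 norm is real-valued, is still
    submultiplicative with constant 1, and splits along real and imaginary parts just as [csum] and
    the integrals do. *)
Definition cnrm z : R := `|complex.Re z| + `|complex.Im z|.

Lemma cnrm_ge0 z : 0 <= cnrm z.
Proof. by rewrite addr_ge0. Qed.

Lemma cnrm0 : cnrm 0 = 0.
Proof. by rewrite /cnrm /= normr0 addr0. Qed.

Lemma cnrm1 : cnrm 1 = 1.
Proof. by rewrite /cnrm /= normr0 addr0 normr1. Qed.

Lemma cnrm_eq0 z : cnrm z <= 0 -> z = 0.
Proof.
case: z => a b; rewrite /cnrm /= => h.
have /eqP : `|a| + `|b| = 0 by apply/eqP; rewrite eq_le h addr_ge0.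
by rewrite paddr_eq0// !normr_eq0 => /andP[/eqP-> /eqP->].
Qed.

Lemma cnrmN z : cnrm (- z) = cnrm z.
Proof. by case: z => a b; rewrite /cnrm /= !normrN. Qed.

Lemma cnrmD z w : cnrm (z + w) <= cnrm z + cnrm w.
Proof.
case: z w => a b [c d]; rewrite /cnrm /= addrACA.
by apply: lerD; apply: ler_normD.
Qed.

Lemma cnrmB z w : cnrm (z - w) <= cnrm z + cnrm w.
Proof. by rewrite -(cnrmN w) cnrmD. Qed.

Lemma cnrmM z w : cnrm (z * w) <= cnrm z * cnrm w.
Proof.
case: z w => a b [c d]; rewrite /cnrm /=.
apply: (@le_trans _ _ ((`|a| * `|c| + `|b| * `|d|) + (`|a| * `|d| + `|b| * `|c|))).
  apply: lerD; rewrite -!normrM; first exact: ler_normB.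
  exact: ler_normD.
by rewrite le_eqVlt; apply/orP; left; apply/eqP; ring.
Qed.

Lemma cnrmX z n : cnrm (z ^+ n) <= cnrm z ^+ n.
Proof.
elim: n => [|n IH]; first by rewrite !expr0 cnrm1.
rewrite !exprS; apply: le_trans (cnrmM _ _) _.
by rewrite ler_wpM2l ?cnrm_ge0.
Qed.

Lemma cnrm_real (x : R) : cnrm x%:C%C = `|x|.
Proof. by rewrite /cnrm /= normr0 addr0. Qed.

Lemma normc_le_cnrm z : `|z| <= (cnrm z)%:C%C.
Proof.
case: z => a b; rewrite normc_def lecR /cnrm /=.
have h : 0 <= `|a| + `|b| by rewrite addr_ge0.
rewrite -(ger0_norm h) -sqrtr_sqr ler_wsqrtr// sqrrD !real_normK ?num_real//.
by rewrite addrAC lerDl mulrn_wge0// mulr_ge0.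
Qed.

Lemma cnrm_le_normc z : (cnrm z)%:C%C <= 2 * `|z|.
Proof.
case: z => a b; rewrite normc_def /cnrm /=.
have -> : 2 = (2%:R : R)%:C%C :> R[i] by rewrite rmorph_nat.
rewrite -rmorphM lecR.
have h (x y : R) : `|x| <= Num.sqrt (x ^+ 2 + y ^+ 2).
  by rewrite -sqrtr_sqr ler_wsqrtr// lerDl sqr_ge0.
by rewrite mulr2n mulrDl mul1r lerD// addrC.
Qed.

Definition rlim (u : nat -> R) : R := lim (u @ \oo).

(* Real and imaginary parts are summed separately because completeness of
   [R[i]] is not available. *)
Definition csum u : R[i] :=
  (rlim (series (fun n => complex.Re (u n))) +i*
   rlim (series (fun n => complex.Im (u n))))%C.

Definition summable_nat v := cvg (series v @ \oo).

(** The tail estimate is the limit, as [m] grows, of the same inequality between the finite blocks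
    from [n] to [m]. *)
Lemma real_tail (x : nat -> R) v : summable_nat v -> (forall n, `|x n| <= v n) ->
  cvg (series x @ \oo) /\
  forall n, `|rlim (series x) - series x n| <= rlim (series v) - series v n.
Proof.
move=> sv xv.
have v0 n : 0 <= v n by apply: le_trans (xv n).
have cx : cvg (series x @ \oo).
  by apply: normed_cvg; apply: series_le_cvg xv sv.
split=> // n.
have c1 : `|series x m - series x n| @[m --> \oo] --> `|rlim (series x) - series x n|.
  by apply: cvg_norm; apply: cvgB; [exact: cx|exact: cvg_cst].
have c2 : (series v m - series v n) @[m --> \oo] --> rlim (series v) - series v n.
  by apply: cvgB; [exact: sv|exact: cvg_cst].
apply: (ler_cvg_to c1 c2).
exists n => // m /= nm; rewrite !sub_series_geq//.
by apply: le_trans (ler_norm_sum _ _ _) _; apply: ler_sum.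
Qed.

Section Dominated.
Variables (v : nat -> R) (u : nat -> R[i]).
Hypotheses (sv : summable_nat v) (uv : forall n, cnrm (u n) <= v n).

Let uRe n : `|complex.Re (u n)| <= v n.
Proof. by apply: le_trans (uv n); rewrite lerDl. Qed.
Let uIm n : `|complex.Im (u n)| <= v n.
Proof. by apply: le_trans (uv n); rewrite lerDr. Qed.

Lemma Re_series n : complex.Re (series u n) = series (fun n => complex.Re (u n)) n.
Proof. by rewrite !seriesEnat /= raddf_sum. Qed.
Lemma Im_series n : complex.Im (series u n) = series (fun n => complex.Im (u n)) n.
Proof. by rewrite !seriesEnat /= raddf_sum. Qed.

Lemma csum_sums : sums_to u (csum u).
Proof.
rewrite /sums_to.
rewrite (_ : series _ = (fun n => (series (fun n => complex.Re (u n)) n +i*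
   series (fun n => complex.Im (u n)) n)%C)); last first.
  by apply/funext => n; rewrite -Re_series -Im_series; case: (series u n).
by apply: complex_cvg; [have [] := real_tail sv uRe|have [] := real_tail sv uIm].
Qed.

(** The factor 2 appears because [v] bounds the real and the imaginary part separately. *)
Lemma csum_tail n :
  cnrm (csum u - series u n) <= 2 * (rlim (series v) - series v n).
Proof.
rewrite [2]mulr2n mulrDl mul1r /cnrm !raddfB /= Re_series Im_series.
have [_ h1] := real_tail sv uRe; have [_ h2] := real_tail sv uIm.
exact: lerD (h1 n) (h2 n).
Qed.

Lemma csum_le : cnrm (csum u) <= 2 * rlim (series v).
Proof. by have := csum_tail 0%N; rewrite !seriesEnat /= !big_geq// !subr0. Qed.
End Dominated.

Lemma summable_nat_tail v : summable_nat v -> rlim (series v) - series v n @[n --> \oo] --> 0.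
Proof.
by move=> sv; rewrite -(subrr (rlim (series v))); apply: cvgB; [exact: cvg_cst|exact: sv].
Qed.

Lemma summable_natZ v (c : R) : summable_nat v -> summable_nat (fun n => c * v n).
Proof. by move=> sv; exact: (@is_cvg_seriesZ _ v c). Qed.

Lemma le_small_eq0 (x : R) (e : nat -> R) :
  e @ \oo --> (0 : R) -> (forall n, x <= e n) -> x <= 0.
Proof. by move=> e0 xe; apply: (ler_cvg_to (@cvg_cst _ x _ \oo _) e0); exists 0%N. Qed.

Lemma sums_to_unique u x y : sums_to u x -> sums_to u y -> x = y.
Proof. by move=> ux uy; exact: (cvg_unique _ ux uy). Qed.

Lemma sums_toD u (w : nat -> R[i]) x y : sums_to u x -> sums_to w y ->
  sums_to (fun n => u n + w n) (x + y).
Proof.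
move=> ux wy; rewrite /sums_to.
rewrite (_ : series _ = (fun n => series (u : nat -> R[i]^o) n + series (w : nat -> R[i]^o) n)).
  by apply: (@cvgD R[i] R[i]^o); [exact: ux|exact: wy].
by apply/funext => n; rewrite !seriesEnat /= big_split.
Qed.

Lemma sums_toZ c u x : sums_to u x -> sums_to (fun n => c * u n) (c * x).
Proof.
move=> ux; rewrite /sums_to.
rewrite (_ : series _ = (fun n => (c : R[i]^o) * series (u : nat -> R[i]^o) n)).
  by apply: (@cvgM R[i]); [exact: cvg_cst|exact: ux].
by apply/funext => n; rewrite !seriesEnat /= mulr_sumr.
Qed.

Lemma sums_toS u x : sums_to (fun n => u n.+1) x -> sums_to u (u 0%N + x).
Proof.
move=> ux; rewrite /sums_to -cvg_shiftS /=.
rewrite (_ : (fun _ => _) = (fun n => (u 0%N : R[i]^o) + series (fun n => u n.+1 : R[i]^o) n)).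
  by apply: (@cvgD R[i] R[i]^o); [exact: cvg_cst|exact: ux].
apply/funext => n; rewrite !seriesEnat /= big_nat_recl// .
Qed.

End ComplexSums.

(** * Geometric coefficient bounds and the germ of the substitution *)

Section Germs.
Variable R : realType.
Implicit Types (z w alpha : R[i]) (a b : nat -> R[i]) (C M : R).

(** A quantitative form of [convergent_series] (see [geo_convergent] and [convergent_geo]). Passing
    to the tail keeps [M] and multiplies [C] by [M], so every bound below is made linear in [C]. *)
Definition geo_bounded C M a : Prop :=
  [/\ 0 <= C, 0 <= M & forall n, cnrm (a n) <= C * M ^+ n].

Definition seq_tail a : nat -> R[i] := fun n => a n.+1.

Lemma geo_tail C M a : geo_bounded C M a -> geo_bounded (C * M) M (seq_tail a).
Proof.
move=> [C0 M0 aM]; split=> // [|n]; first exact: mulr_ge0.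
by rewrite -mulrA -exprS; exact: aM.
Qed.

Lemma geo_half_summable C : summable_nat (fun n => C * (2^-1 : R) ^+ n) /\
  rlim (series (fun n => C * (2^-1 : R) ^+ n)) = 2 * C.
Proof.
have h : `|2^-1 : R| < 1 by rewrite ger0_norm; lra.
have := @cvg_geometric_series R C _ h.
have -> : C / (1 - 2^-1) = 2 * C by field.
by move=> c; split; [apply/cvg_ex; exists (2 * C)|exact: cvg_lim c].
Qed.

(** On the disc [M |z| <= 1/2] the dominating series does not depend on [z] or [M], only on [C]. *)
Lemma geo_dom C M a z n : geo_bounded C M a -> M * cnrm z <= 2^-1 ->
  cnrm (a n * z ^+ n) <= C * 2^-1 ^+ n.
Proof.
move=> [C0 M0 aM] Mz; apply: le_trans (cnrmM _ _) _.
apply: (@le_trans _ _ ((C * M ^+ n) * cnrm z ^+ n)).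
  by apply: ler_pM; rewrite ?cnrm_ge0 ?aM ?cnrmX.
rewrite -mulrA -exprMn ler_wpM2l// lerXn2r ?nnegrE ?mulr_ge0 ?cnrm_ge0//.
Qed.

Definition peval a z : R[i] := csum (fun n => a n * z ^+ n).

Lemma peval_sums C M a z : geo_bounded C M a -> M * cnrm z <= 2^-1 ->
  sums_to (fun n => a n * z ^+ n) (peval a z).
Proof.
move=> aM Mz; apply: csum_sums (geo_half_summable C).1 _ => n.
exact: geo_dom aM Mz.
Qed.

(** The 4 is 2 from [csum_le] times 2 from the geometric series of ratio 1/2. *)
Lemma peval_le C M a z : geo_bounded C M a -> M * cnrm z <= 2^-1 ->
  cnrm (peval a z) <= 4 * C.
Proof.
move=> aM Mz; have [s l] := geo_half_summable C.
have := csum_le s (fun n => geo_dom n aM Mz).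
by rewrite l mulrA -natrM.
Qed.

Lemma peval_rec C M a z : geo_bounded C M a -> M * cnrm z <= 2^-1 ->
  peval a z = a 0%N + z * peval (seq_tail a) z.
Proof.
move=> aM Mz; apply: sums_to_unique (peval_sums aM Mz) _.
have -> : a 0%N = a 0%N * z ^+ 0 by rewrite expr0 mulr1.
apply: (@sums_toS _ (fun n => a n * z ^+ n)).
rewrite (_ : (fun n => _) = (fun n => z * (seq_tail a n * z ^+ n))).
  by apply: sums_toZ; apply: peval_sums (geo_tail aM) Mz.
by apply/funext => n; rewrite exprS mulrCA.
Qed.

Lemma cnrm_small (r : R) z : `|z| < r%:C%C -> cnrm z <= 2 * r.
Proof.
move=> zr; rewrite -lecR; apply: le_trans (cnrm_le_normc z) _.
by rewrite rmorphM rmorph_nat ler_wpM2l// ltW.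
Qed.

Lemma geo_convergent C M a : geo_bounded C M a -> convergent_series a.
Proof.
(* With this radius [r], [M * cnrm z <= 2 M r = (M / (M + 1)) / 2 <= 1/2]; the [+ 1] keeps [r]
   finite when [M = 0]. *)
move=> aM; have [C0 M0 _] := aM; exists (4 * (M + 1))^-1 => [|z zr].
  by rewrite invr_gt0; lra.
exists (peval a z); apply: (peval_sums aM).
apply: le_trans (ler_wpM2l M0 (cnrm_small zr)) _.
rewrite invfM mulrA (_ : _ * _ = (M / (M + 1)) * 2^-1); last by field; lra.
by rewrite ler_piMl// ler_pdivrMr; lra.
Qed.

(** Convergence at the single point [x = r / 2] makes the terms [a_n x^n] tend to 0, hence bounded,
    which gives the bound with [M = 1 / x]. *)
Lemma convergent_geo a : convergent_series a -> exists C M, geo_bounded C M a.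
Proof.
move=> [r r0 ar]; pose x := r / 2; have x0 : 0 < x by rewrite divr_gt0.
have [|s /cvgP/cvg_series_cvg_0 s0] := ar x%:C%C.
  by rewrite normc_def /= expr0n addr0 sqrtr_sqr ltcR gtr0_norm// /x; lra.
have := (@cvgrPdist_lt _ _ _ _ _ _ _).1 s0 1 ltr01; move=> [N _ NP].
(* The sum covers the indices below [N]. The 2 covers the others: there the modulus of [a_n x^n] is
   below 1, and [cnrm] is at most twice the modulus. *)
exists (2 + \sum_(k < N) cnrm (a k) * x ^+ k), x^-1; split.
- by rewrite addr_ge0// sumr_ge0// => k _; rewrite mulr_ge0 ?cnrm_ge0// exprn_ge0// ltW.
- by rewrite invr_ge0 ltW.
move=> n; rewrite exprVn ler_pdivlMr ?exprn_gt0//.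
have [nN|Nn] := ltnP n N.
  rewrite (bigD1 (Ordinal nN))//= addrCA lerDl addr_ge0// sumr_ge0// => k _.
  by rewrite mulr_ge0 ?cnrm_ge0// exprn_ge0// ltW.
have h : cnrm (a n * x%:C%C ^+ n) <= 2.
  have := NP n Nn; rewrite /= sub0r normrN => h.
  have := @cnrm_small 1 (a n * x%:C%C ^+ n); rewrite mulr1; apply.
  by rewrite rmorph1.
have e : cnrm (a n * x%:C%C ^+ n) = cnrm (a n) * x ^+ n.
  rewrite -rmorphXn; case: (a n) => p q; rewrite /cnrm /= !mulr0 subr0 add0r.
  by rewrite !normrM -mulrDl (ger0_norm (exprn_ge0 _ (ltW x0))).
rewrite -e (le_trans h)// lerDl sumr_ge0// => k _.
by rewrite mulr_ge0 ?cnrm_ge0// exprn_ge0// ltW.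
Qed.

(* The coefficients [b] of [sum_n a_n w^n], where [w = Z / (1 - alpha Z)], are
   computed from the two identities [A = a_0 + w A'] and
   [(1 - alpha Z) w = Z]. *)
Fixpoint mobius_coef alpha (n : nat) a : R[i] :=
  if n is m.+1 then
    mobius_coef alpha m (seq_tail a) + (if m is 0 then 0 else alpha * mobius_coef alpha m a)
  else a 0%N.

Definition mobius alpha a : nat -> R[i] := fun n => mobius_coef alpha n a.

Lemma mobius0 alpha a : mobius alpha a 0 = a 0%N.
Proof. by []. Qed.

Lemma mobiusS alpha a n : mobius alpha a n.+1 =
  mobius alpha (seq_tail a) n + (if n is 0 then 0 else alpha * mobius alpha a n).
Proof. by []. Qed.

(** With [P = M + |alpha|], the recursion [mobiusS] bounds the next coefficient by
    [(C M) P^n + |alpha| C P^n = C P^(n+1)], so the bound reproduces itself; the induction runs over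
    all [a] and [C] because of the tail. *)
Lemma geo_mobius alpha C M a : geo_bounded C M a ->
  geo_bounded C (M + cnrm alpha) (mobius alpha a).
Proof.
move=> aM; have [C0 M0 _] := aM; split=> // [|n]; first by rewrite addr_ge0 ?cnrm_ge0.
elim: n C C0 a aM => [|n IH] C C0 a aM.
  by have [_ _ /(_ 0%N)] := aM; rewrite !expr0.
rewrite mobiusS exprS mulrDl mulrDr; apply: le_trans (cnrmD _ _) _.
apply: lerD.
  by rewrite mulrA; apply: IH (geo_tail aM); exact: mulr_ge0.
have h : 0 <= C * (cnrm alpha * (M + cnrm alpha) ^+ n).
  by rewrite !mulr_ge0 ?exprn_ge0 ?addr_ge0 ?cnrm_ge0.
case: n IH h => [|n] IH h; first by rewrite cnrm0.
apply: le_trans (cnrmM _ _) _; rewrite mulrCA ler_wpM2l ?cnrm_ge0//.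
exact: IH.
Qed.

(** From [(1 - q)^-1 = 1 + q (1 - q)^-1], the norm [x] of the inverse satisfies [x <= 1 + x / 2],
    hence [x <= 2]. *)
Lemma cnrm_inv_le (q : R[i]) : cnrm q <= 2^-1 -> 1 - q != 0 /\ cnrm (1 - q)^-1 <= 2.
Proof.
move=> q2; have q1 : 1 - q != 0.
  apply: contraTneq q2 => /eqP; rewrite subr_eq0 => /eqP <-.
  by rewrite cnrm1 -ltNge; lra.
split=> //; have e : (1 - q)^-1 = 1 + q * (1 - q)^-1 by field.
have : cnrm (1 - q)^-1 <= 1 + 2^-1 * cnrm (1 - q)^-1.
  rewrite {1}e; apply: le_trans (cnrmD _ _) _; rewrite cnrm1 lerD2l.
  by apply: le_trans (cnrmM _ _) _; rewrite ler_wpM2r ?cnrm_ge0.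
by lra.
Qed.

Section Germ.
Variables (alpha z : R[i]) (M : R).
Hypothesis M0 : 0 <= M.
(** The factor 4 puts both points in their discs: [(M + |alpha|) |z| <= 1/2] for the series [b], and
    [M |w| <= 1/2] for the series [a], since [|w| <= 2 |z|]. *)
Hypothesis zM : 4 * (M + cnrm alpha) * cnrm z <= 1.
Let w := z / (1 - alpha * z).

Let b0 := cnrm_ge0 alpha.
Let z0 := cnrm_ge0 z.

Let Mz : (M + cnrm alpha) * cnrm z <= 2^-1.
Proof. by move: zM; rewrite -mulrA; lra. Qed.

Let az : cnrm (alpha * z) <= 2^-1.
Proof.
apply: le_trans (cnrmM _ _) _; apply: le_trans Mz.
by rewrite ler_wpM2r// lerDr.
Qed.

Let Mw : M * cnrm w <= 2^-1.
Proof.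
have [_ h] := cnrm_inv_le az.
apply: (@le_trans _ _ (M * (2 * cnrm z))).
  rewrite ler_wpM2l//; apply: le_trans (cnrmM _ _) _.
  by rewrite mulrC ler_wpM2r.
have : M * cnrm z <= (M + cnrm alpha) * cnrm z by rewrite ler_wpM2r// lerDl.
by move: zM; rewrite -mulrA; lra.
Qed.

Let defect a := peval a w - peval (mobius alpha a) z.

Let defect_rec C a : geo_bounded C M a -> defect a = w * defect (seq_tail a).
Proof.
move=> aM; rewrite /defect (peval_rec aM Mw).
have bM := geo_mobius alpha aM.
have b'M := geo_mobius alpha (geo_tail aM).
have sb' := peval_sums b'M Mz.
have sb := peval_sums (geo_tail bM) Mz.
have [q1 _] := cnrm_inv_le az.
rewrite (peval_rec bM Mz) mobius0.
(* The term with [alpha] in [mobiusS] is missing at [n = 0], so it sums to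
   [alpha (B - b_0) = alpha z B']. *)
have e : peval (seq_tail (mobius alpha a)) z =
    peval (mobius alpha (seq_tail a)) z + alpha * (z * peval (seq_tail (mobius alpha a)) z).
  apply: (sums_to_unique sb).
  rewrite -[X in alpha * X]add0r.
  rewrite (_ : (fun n => _) = (fun n => mobius alpha (seq_tail a) n * z ^+ n +
      alpha * ((if n is 0 then 0 else mobius alpha a n) * z ^+ n))); last first.
    apply/funext => -[|n]; first by rewrite /seq_tail mobiusS !mul0r mulr0 !addr0.
    by rewrite {1}/seq_tail mobiusS; ring.
  apply: sums_toD sb' _; apply: sums_toZ.
  rewrite -[X in X + _](mul0r (z ^+ 0)).
  apply: (@sums_toS _ (fun n => (if n is 0 then 0 else mobius alpha a n) * z ^+ n)).
  rewrite (_ : (fun n => _) = (fun n => z * (seq_tail (mobius alpha a) n * z ^+ n))).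
    exact: sums_toZ sb.
  by apply/funext => n; rewrite exprS mulrCA.
(* Multiplying by [w] gives [z B' = w B(a')], the same recursion as for [A]. *)
have : (1 - alpha * z) * peval (seq_tail (mobius alpha a)) z = peval (mobius alpha (seq_tail a)) z.
  by rewrite mulrBl mul1r {1}e; ring.
by move=> <-; rewrite /w; field.
Qed.

(** The 8 adds the two bounds [4 C] of [peval_le]; each use of [defect_rec] replaces [C] by [C M]
    and contributes [|w|], a gain of [M |w| <= 1/2]. *)
Let defect_le n C a : geo_bounded C M a -> cnrm (defect a) <= 8 * C * 2^-1 ^+ n.
Proof.
elim: n C a => [|n IH] C a aM.
  have h1 := peval_le aM Mw; have h2 := peval_le (geo_mobius alpha aM) Mz.
  rewrite expr0 mulr1; apply: le_trans (cnrmB _ _) _; lra.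
rewrite (defect_rec aM); apply: le_trans (cnrmM _ _) _.
apply: le_trans (ler_wpM2l (cnrm_ge0 _) (IH _ _ (geo_tail aM))) _.
have [C0 _ _] := aM.
rewrite (_ : cnrm w * _ = (8 * C * 2^-1 ^+ n) * (M * cnrm w)); last by ring.
rewrite exprSr [leRHS]mulrA ler_wpM2l// !mulr_ge0// exprn_ge0//; lra.
Qed.

Lemma peval_mobius C a : geo_bounded C M a -> peval a w = peval (mobius alpha a) z.
Proof.
move=> aM; apply/eqP; rewrite -subr_eq0; apply/eqP/cnrm_eq0.
apply: (@le_small_eq0 _ _ (fun n => 8 * C * 2^-1 ^+ n)) => [|n]; last exact: defect_le aM.
rewrite -(mulr0 (8 * C)); apply: cvgM; first exact: cvg_cst.
by apply: cvg_expr; rewrite ger0_norm; lra.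
Qed.

Lemma peval_mobius_sums C a : geo_bounded C M a ->
  exists x, sums_to (fun n => mobius alpha a n * z ^+ n) x /\
            sums_to (fun n => a n * w ^+ n) x.
Proof.
move=> aM; exists (peval a w); split; last exact: peval_sums aM Mw.
by rewrite (peval_mobius aM); exact: peval_sums (geo_mobius alpha aM) Mz.
Qed.
End Germ.

Lemma mobius_germ alpha C M a : geo_bounded C M a ->
  subst_germ alpha a (mobius alpha a).
Proof.
move=> aM; have [C0 M0 _] := aM; have b0 := cnrm_ge0 alpha.
(* Since [cnrm z <= 2 r], the quantity [4 (M + |alpha|) cnrm z] is at most
   [(M + |alpha|) / (M + |alpha| + 1) <= 1]. *)
exists (8 * (M + cnrm alpha + 1))^-1 => [|z zr]; first by rewrite invr_gt0; lra.
apply: (@peval_mobius_sums alpha z M M0 _ C a aM).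
apply: le_trans (ler_wpM2l _ (cnrm_small zr)) _; first by lra.
rewrite [leLHS](_ : _ = (M + cnrm alpha) / (M + cnrm alpha + 1)); last by field; lra.
by rewrite ler_pdivrMr; lra.
Qed.
End Germs.

(** * Integrals of continuous complex functions, monomials and exponentials *)

Section ComplexIntegral.
Variable R : realType.
Local Notation mu := (@lebesgue_measure R).
Implicit Types (h k : R -> R[i]) (t : R).

Local Notation ccont h := (continuous (h : R -> R[i]^o)).

Lemma continuous_Re h : ccont h -> continuous (fun u => complex.Re (h u)).
Proof.
move=> ch u; apply: (@continuous_comp _ _ _ (h : R -> R[i]^o) (@complex.Re R : R[i]^o -> R)).
  exact: ch.
exact: Re_continuous.
Qed.

Lemma continuous_Im h : ccont h -> continuous (fun u => complex.Im (h u)).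
Proof.
move=> ch u; apply: (@continuous_comp _ _ _ (h : R -> R[i]^o) (@complex.Im R : R[i]^o -> R)).
  exact: ch.
exact: Im_continuous.
Qed.

Lemma continuous_cnrm h : ccont h -> continuous (fun u => cnrm (h u)).
Proof.
move=> ch u; apply: cvgD; apply: cvg_norm.
  exact: continuous_Re.
exact: continuous_Im.
Qed.

Lemma ccontD h k : ccont h -> ccont k -> ccont (fun u => h u + k u).
Proof. by move=> ch ck u; apply: (@cvgD R[i] R[i]^o); [exact: ch|exact: ck]. Qed.

Lemma ccont_real (f : R -> R) : continuous f -> ccont (fun u => (f u)%:C%C).
Proof. by move=> cf; apply: complex_continuous => // u; exact: cvg_cst. Qed.

Lemma ccont_cst (c : R[i]) : ccont (fun=> c).
Proof. by move=> u; exact: cvg_cst. Qed.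

Lemma ccontZ (c : R[i]) h : ccont h -> ccont (fun u => c * h u).
Proof. by move=> ch u; apply: (@cvgM R[i]); [exact: cvg_cst|exact: ch]. Qed.

Lemma ccontM h k : ccont h -> ccont k -> ccont (fun u => h u * k u).
Proof. by move=> ch ck u; apply: (@cvgM R[i]); [exact: ch|exact: ck]. Qed.

Lemma ccont_rev h t : ccont h -> ccont (fun u => h (t - u)).
Proof.
move=> ch u; apply: (@continuous_comp _ _ _ (fun u => t - u) (h : R -> R[i]^o)); last exact: ch.
by apply: cvgB; [exact: cvg_cst|exact: cvg_id].
Qed.

(** Has the shape of [conv_fun], so that [convE] holds by computation. *)
Definition cint h t : R[i] :=
  ((\int[mu]_(u in `[0, t]) complex.Re (h u)) +i*
   (\int[mu]_(u in `[0, t]) complex.Im (h u)))%C.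

Lemma eq_cint h k t : (forall u, 0 <= u <= t -> h u = k u) -> cint h t = cint k t.
Proof.
by move=> hk; congr (_ +i* _)%C; apply: eq_Rintegral => u;
  rewrite inE /= in_itv /= => /hk ->.
Qed.

Lemma cintD h k t : ccont h -> ccont k ->
  cint (fun u => h u + k u) t = cint h t + cint k t.
Proof.
move=> ch ck; rewrite /cint.
under eq_Rintegral do rewrite raddfD.
under [X in (_ +i* X)%C]eq_Rintegral do rewrite raddfD.
rewrite !RintegralD//; apply: cont_integrable;
  by [exact: continuous_Re|exact: continuous_Im].
Qed.

Lemma cintZ (c : R[i]) h t : ccont h -> cint (fun u => c * h u) t = c * cint h t.
Proof.
move=> ch; case: c => a b.
have iRe : mu.-integrable `[0, t] (EFin \o (fun u => complex.Re (h u))).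
  by apply: cont_integrable; exact: continuous_Re.
have iIm : mu.-integrable `[0, t] (EFin \o (fun u => complex.Im (h u))).
  by apply: cont_integrable; exact: continuous_Im.
have iZ (e : R) f : continuous f -> mu.-integrable `[0, t] (EFin \o (fun u => e * f u)).
  by move=> cf; apply: cont_integrable => u; apply: cvgM; [exact: cvg_cst|exact: cf].
rewrite -[RHS]/((a * _ - b * _) +i* (a * _ + b * _))%C -!RintegralZl//.
have [cr ci] := (continuous_Re ch, continuous_Im ch).
rewrite -RintegralB//; [|exact: iZ..].
rewrite -RintegralD//; [|exact: iZ..].
congr (_ +i* _)%C; apply: eq_Rintegral => u _; by case: (h u).
Qed.

Lemma cintB h k t : ccont h -> ccont k ->
  cint (fun u => h u - k u) t = cint h t - cint k t.
Proof.
move=> ch ck; rewrite (@eq_cint _ (fun u => h u + -1 * k u)); last first.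
  by move=> u _; rewrite mulN1r.
by rewrite (cintD t ch (ccontZ (c:=-1) ck)) (cintZ (-1) t ck) mulN1r.
Qed.

Lemma cint_le h (b : R -> R) t : ccont h -> continuous b ->
  (forall u, 0 <= u <= t -> cnrm (h u) <= b u) ->
  cnrm (cint h t) <= \int[mu]_(u in `[0, t]) b u.
Proof.
move=> ch cb hb; rewrite /cnrm /=.
have cr := continuous_Re ch; have ci := continuous_Im ch.
have inorm f : continuous f -> mu.-integrable `[0, t] (EFin \o (fun u : R => `|f u : R|)).
  by move=> cf; apply: cont_integrable => u; apply: cvg_norm; exact: cf.
apply: le_trans (lerD (le_normr_Rintegral _ _) (le_normr_Rintegral _ _)) _ => //;
  try exact: cont_integrable.
rewrite -RintegralD//; try exact: inorm.
apply: le_Rintegral => //.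
- by apply: cont_integrable; exact: continuous_cnrm ch.
- exact: cont_integrable.
Qed.

Lemma rint_FTC (F f : R -> R) t : 0 <= t -> continuous f ->
  (forall x : R, is_derive x (1 : R) F (f x)) -> \int[mu]_(u in `[0, t]) f u = F t - F 0.
Proof.
rewrite le_eqVlt => /predU1P[<-|t0] cf dF.
  by rewrite subrr set_itv1 Rintegral_set1.
have cF : continuous F.
  move=> x; apply: differentiable_continuous; apply/derivable1_diffP.
  exact: (@ex_derive _ _ _ _ _ _ _ (dF x)).
rewrite /Rintegral (@continuous_FTC2 _ f F)//.
- exact: continuous_subspaceT.
- split.
  + by move=> x _; exact: (@ex_derive _ _ _ _ _ _ _ (dF x)).
  + by apply: cvg_at_right_filter; exact: cF.
  + by apply: cvg_at_left_filter; exact: cF.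
- by move=> x _; rewrite derive1E; exact: (@derive_val _ _ _ _ _ _ _ (dF x)).
Qed.

Lemma cint_FTC (F : R -> R[i]) h t : 0 <= t -> ccont h ->
  (forall x : R, is_derive x (1 : R) (fun u => complex.Re (F u)) (complex.Re (h x))) ->
  (forall x : R, is_derive x (1 : R) (fun u => complex.Im (F u)) (complex.Im (h x))) ->
  cint h t = F t - F 0.
Proof.
move=> t0 ch dRe dIm; rewrite /cint (rint_FTC t0 (continuous_Re ch) dRe).
by rewrite (rint_FTC t0 (continuous_Im ch) dIm); case: (F t) (F 0) => a b [c d].
Qed.

Lemma is_derive_monomial (c : R) n (x : R) :
  is_derive x (1 : R) (fun u => c * (u ^+ n.+1 / n.+1`!%:R)) (c * (x ^+ n / n`!%:R)).
Proof.
have h := is_deriveZ (c / n.+1`!%:R) (is_deriveX n.+1 (is_derive_id x (1 : R))).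
rewrite (_ : (fun u => _) = (c / n.+1`!%:R) \*: (id ^+ n.+1)); last first.
  by apply/funext => u; rewrite /= exprfctE -[RHS]/(_ * _) /=; ring.
apply: (is_derive_eq h); rewrite -[LHS]/(_ * (_ * 1)) mulr1 factS natrM /=.
have n0 : (n`!%:R : R) != 0 by rewrite pnatr_eq0 -lt0n fact_gt0.
by field; rewrite n0 nat1r pnatr_eq0.
Qed.

Lemma continuous_monomial (c : R) n : continuous (fun u : R => c * (u ^+ n / n`!%:R) : R).
Proof.
move=> x; apply: cvgM; first exact: cvg_cst.
by apply: cvgM; [exact: exprn_continuous|exact: cvg_cst].
Qed.

Lemma rint_monomial (c : R) n t : 0 <= t ->
  \int[mu]_(u in `[0, t]) (c * (u ^+ n / n`!%:R)) = c * (t ^+ n.+1 / n.+1`!%:R).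
Proof.
move=> t0; rewrite (rint_FTC t0 (@continuous_monomial c n) (is_derive_monomial c n)).
by rewrite expr0n /= mul0r mulr0 subr0.
Qed.

(** The function that represents [c l^(n+1)] (see [emb_monomial]); with the factorial, integration
    merely raises [n] by one. *)
Definition cmonomial (c : R[i]) n (t : R) : R[i] := c * (t ^+ n / n`!%:R)%:C%C.

Lemma ccont_cmonomial c n : ccont (cmonomial c n).
Proof.
apply: ccontZ.
apply: ccont_real => x.
by apply: cvgM; [exact: exprn_continuous|exact: cvg_cst].
Qed.

Lemma cint_cmonomial c n t : 0 <= t -> cint (cmonomial c n) t = cmonomial c n.+1 t.
Proof.
move=> t0; case: c => a b.
have dRe (x : R) : is_derive x (1 : R) (fun u => complex.Re (cmonomial (a +i* b)%C n.+1 u))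
    (complex.Re (cmonomial (a +i* b)%C n x)).
  rewrite (_ : (fun _ => _) = (fun u => a * (u ^+ n.+1 / n.+1`!%:R))); last first.
    by apply/funext => u; rewrite /= mulr0 subr0.
  by rewrite /= mulr0 subr0; exact: is_derive_monomial.
have dIm (x : R) : is_derive x (1 : R) (fun u => complex.Im (cmonomial (a +i* b)%C n.+1 u))
    (complex.Im (cmonomial (a +i* b)%C n x)).
  rewrite (_ : (fun _ => _) = (fun u => b * (u ^+ n.+1 / n.+1`!%:R))); last first.
    by apply/funext => u; rewrite /= mulr0 add0r.
  by rewrite /= mulr0 add0r; exact: is_derive_monomial.
rewrite (cint_FTC t0 (@ccont_cmonomial (a +i* b)%C n) dRe dIm).
by rewrite /cmonomial expr0n /= mul0r mulr0 subr0.
Qed.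

Definition cexpt (alpha : R[i]) t : R[i] := cexp (alpha * t%:C%C).

Lemma cexptE a b t : cexpt (a +i* b)%C t =
  (expR (a * t) * cos (b * t) +i* (expR (a * t) * sin (b * t)))%C.
Proof.
rewrite /cexpt (_ : (a +i* b)%C * t%:C%C = (a * t +i* (b * t))%C); last by simpc.
by rewrite /cexp /=; simpc.
Qed.

Lemma cexpt0 alpha : cexpt alpha 0 = 1.
Proof. by case: alpha => a b; rewrite cexptE !mulr0 expR0 cos0 sin0 !mul1r. Qed.

Lemma cexptD alpha t s : cexpt alpha (t + s) = cexpt alpha t * cexpt alpha s.
Proof.
case: alpha => a b; rewrite !cexptE !mulrDr expRD cosD sinD.
by apply/eqP; rewrite eq_complex /=; apply/andP; split; apply/eqP; ring.
Qed.

Lemma cexptDl alpha beta t : cexpt (alpha + beta) t = cexpt alpha t * cexpt beta t.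
Proof.
case: alpha beta => a b [c d]; rewrite -[(_ + _)]/((a + c) +i* (b + d))%C.
rewrite !cexptE !mulrDl expRD cosD sinD.
by apply/eqP; rewrite eq_complex /=; apply/andP; split; apply/eqP; ring.
Qed.

Lemma cexpt0l t : cexpt 0 t = 1.
Proof. by rewrite -[0]/(0 +i* 0)%C cexptE !mul0r expR0 cos0 sin0 !mul1r. Qed.

Lemma ccont_cexpt alpha : ccont (cexpt alpha).
Proof.
case: alpha => a b.
have cm (c : R) : continuous (fun t => c * t).
  by move=> x; apply: cvgM; [exact: cvg_cst|exact: cvg_id].
have -> : cexpt (a +i* b)%C =
   (fun t => (expR (a * t) * cos (b * t) +i* (expR (a * t) * sin (b * t)))%C).
  by apply/funext => t; rewrite cexptE.
apply: complex_continuous => t; apply: cvgM.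
- by apply: (@continuous_comp _ _ _ _ expR); [exact: cm|exact: continuous_expR].
- by apply: (@continuous_comp _ _ _ _ cos); [exact: cm|exact: continuous_cos].
- by apply: (@continuous_comp _ _ _ _ expR); [exact: cm|exact: continuous_expR].
- by apply: (@continuous_comp _ _ _ _ sin); [exact: cm|exact: continuous_sin].
Qed.

(** The integrated form of [e' = alpha e]. Keeping [alpha] as a factor on the left covers
    [alpha = 0] too. *)
Lemma cint_cexpt alpha t : 0 <= t -> alpha * cint (cexpt alpha) t = cexpt alpha t - 1.
Proof.
move=> t0; rewrite -cintZ; last exact: ccont_cexpt.
rewrite -(cexpt0 alpha); apply: cint_FTC => //.
- exact/ccontZ/ccont_cexpt.
- move=> x; case: alpha => a b.
  rewrite (_ : (fun _ => _) = (fun u => expR (a * u) * cos (b * u))); last first.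
    by apply/funext => u; rewrite cexptE.
  rewrite cexptE /=.
  have da : is_derive x (1 : R) ( *%R a) a.
    by have := is_deriveZ a (is_derive_id x (1 : R)); rewrite -[a *: _]/(_ * _) mulr1.
  have db : is_derive x (1 : R) ( *%R b) b.
    by have := is_deriveZ b (is_derive_id x (1 : R)); rewrite -[b *: _]/(_ * _) mulr1.
  have h := is_deriveM (is_derive1_comp (is_derive_expR (a * x)) da)
     (is_derive1_comp (is_derive_cos (b * x)) db).
  apply: (is_derive_eq h); rewrite -[LHS]/(_ * _ + _ * _) /=; ring.
- move=> x; case: alpha => a b.
  rewrite (_ : (fun _ => _) = (fun u => expR (a * u) * sin (b * u))); last first.
    by apply/funext => u; rewrite cexptE.
  rewrite cexptE /=.
  have da : is_derive x (1 : R) ( *%R a) a.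
    by have := is_deriveZ a (is_derive_id x (1 : R)); rewrite -[a *: _]/(_ * _) mulr1.
  have db : is_derive x (1 : R) ( *%R b) b.
    by have := is_deriveZ b (is_derive_id x (1 : R)); rewrite -[b *: _]/(_ * _) mulr1.
  have h := is_deriveM (is_derive1_comp (is_derive_expR (a * x)) da)
     (is_derive1_comp (is_derive_sin (b * x)) db).
  apply: (is_derive_eq h); rewrite -[LHS]/(_ * _ + _ * _) /=; ring.
Qed.

End ComplexIntegral.

(** * The convolution ring, uniform convergence, and the two operators on functions *)

Section Convolution.
Variable R : realType.
Local Notation conv := Defs.conv.
Local Notation mu := (@lebesgue_measure R).
Implicit Types (f g h : Cplus R) (t T : R).
Local Notation ccont h := (continuous (h : R -> R[i]^o)).

Lemma ccont_Cplus f : ccont (f : R -> R[i]).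
Proof. exact: Cplus_continuous. Qed.

Lemma ccont_conv f g t : ccont (fun u => f (t - u) * g u).
Proof. by apply: ccontM; [exact/ccont_rev/ccont_Cplus|exact: ccont_Cplus]. Qed.

Lemma convE f g t : conv f g t = cint (fun u => f (t - u) * g u) t.
Proof. by []. Qed.

Lemma CplusB f g t : (f - g) t = f t - g t.
Proof. by []. Qed.

Lemma CplusD f g t : (f + g) t = f t + g t.
Proof. by []. Qed.

Lemma Cplus0 t : (0 : Cplus R) t = 0.
Proof. by []. Qed.

Lemma convBr f g h : conv f (g - h) = conv f g - conv f h.
Proof.
apply: Cplus_ext => t _; rewrite CplusB !convE -cintB; try exact: ccont_conv.
by apply: eq_cint => u _; rewrite CplusB mulrBr.
Qed.

Lemma convDr f g h : conv f (g + h) = conv f g + conv f h.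
Proof.
apply: Cplus_ext => t _; rewrite CplusD !convE -cintD; try exact: ccont_conv.
by apply: eq_cint => u _; rewrite CplusD mulrDr.
Qed.

Lemma convr0 f : conv f 0 = 0.
Proof. by rewrite -[X in conv f X](subrr 0) convBr subrr. Qed.

Lemma CcstE (c : R[i]) t : Ccst c t = c.
Proof. by []. Qed.

Lemma conv_cst (c : R[i]) f t : conv (Ccst c) f t = c * cint f t.
Proof. by rewrite convE -cintZ; last exact: ccont_Cplus. Qed.

Lemma cnrm_bounded f T : exists2 K, 0 <= K & forall t, 0 <= t <= T -> cnrm (f t) <= K.
Proof.
have cf := continuous_cnrm (@ccont_Cplus f).
have [K KP] := cont_bounded 0 T cf; exists (`|K|); first exact: normr_ge0.
by move=> t /KP; rewrite ger0_norm ?cnrm_ge0// => h; apply: le_trans h (ler_norm _).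
Qed.

(** The bound [b] stays a function because the iteration in [defect_eq0] feeds in a monomial and
    integrates it. *)
Lemma cnrm_conv_le f g (A T : R) (b : R -> R) t : 0 <= t <= T -> continuous b ->
  (forall u, 0 <= u <= T -> cnrm (f u) <= A) ->
  (forall u, 0 <= u <= T -> cnrm (g u) <= b u) ->
  cnrm (conv f g t) <= \int[mu]_(u in `[0, t]) (A * b u).
Proof.
move=> /andP[t0 tT] cb fA gb; rewrite convE; apply: cint_le.
- exact: ccont_conv.
- by move=> u; apply: cvgM; [exact: cvg_cst|exact: cb].
move=> u /andP[u0 ut]; apply: le_trans (cnrmM _ _) _.
apply: ler_pM; rewrite ?cnrm_ge0//; [apply: fA|apply: gb]; apply/andP; split; lra.
Qed.

Lemma cnrm_conv_le_cst f g (A B T : R) t : 0 <= t <= T ->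
  (forall u, 0 <= u <= T -> cnrm (f u) <= A) ->
  (forall u, 0 <= u <= T -> cnrm (g u) <= B) ->
  cnrm (conv f g t) <= A * B * t.
Proof.
move=> tT fA gB; apply: le_trans (cnrm_conv_le tT (@cst_continuous _ _ B) fA gB) _.
have t0 : 0 <= t by case/andP: tT.
have -> : \int[mu]_(u in `[0, t]) (A * B) = \int[mu]_(u in `[0, t]) (A * B * (u ^+ 0 / 0`!%:R)).
  by apply: eq_Rintegral => u _; rewrite expr0 fact0 divr1 mulr1.
by rewrite rint_monomial// expr1 factS fact0 muln1 divr1.
Qed.

(** The uniform convergence of [Qlim] restated with the real-valued norm ([ucvgP]). *)
Definition ucvg (g : nat -> Cplus R) h : Prop :=
  forall T e, 0 < e -> exists N, forall n, (N <= n)%N ->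
    forall t, 0 <= t <= T -> cnrm (g n t - h t) <= e.

Lemma ucvgP (g : nat -> Cplus R) h :
  (forall t : R,
    {uniform `[0, t], (fun n => g n : R -> R[i]^o) @ \oo --> (h : R -> R[i]^o)}) <->
  ucvg g h.
Proof.
split=> [H T e e0|H T].
- have := H T.
  move=> /(_ [set k : R -> R[i]^o | forall t, 0 <= t <= T -> cnrm (k t - h t) <= e]).
  case=> [|N _ NP]; last by exists N => n /NP.
    apply/uniform_nbhs.
  (* Radius [e / 2], because passing from the modulus to [cnrm] costs a factor 2. *)
  exists [set xy : R[i]^o * R[i]^o | ball xy.1 (e / 2)%:C%C xy.2]; split.
    by rewrite -entourage_ballE; exists (e / 2)%:C%C => //=; rewrite ltcR divr_gt0.
  move=> k hk t /= tT; have /= := hk t.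
  rewrite in_itv /= => /(_ tT); rewrite -ball_normE /= => /cnrm_small.
  by rewrite -opprB cnrmN mulrC divfK.
- move=> P /uniform_nbhs[E [+ subP]].
  rewrite -entourage_ballE => -[e /= e0 sE].
  (* Entourages of [R[i]] are measured by positive elements of [R[i]]; such an element is real. *)
  have e0' : 0 < complex.Re e by move: e0; rewrite ltcE => /andP[].
  have ee : e = (complex.Re e)%:C%C.
    by move: e0; rewrite ltcE /= => /andP[/eqP]; case: (e) => a b /= ->.
  have [|N NP] := H T (complex.Re e / 2); first by rewrite divr_gt0.
  exists N => // n /= nN; apply: subP => t /=; rewrite in_itv /= => tT.
  apply: sE; rewrite /= -ball_normE /=.
  apply: le_lt_trans (normc_le_cnrm _) _.
  rewrite ee ltcR -opprB cnrmN; apply: le_lt_trans (NP _ nN _ tT) _.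
  by lra.
Qed.

Lemma ucvg_pt (g : nat -> Cplus R) h k t : 0 <= t -> ucvg g h -> ucvg g k -> h t = k t.
Proof.
move=> t0 gh gk; apply/eqP; rewrite -subr_eq0; apply/eqP/cnrm_eq0.
apply/ler_addgt0Pr => e e0; rewrite add0r.
have [|N NP] := gh t (e / 2); first by rewrite divr_gt0.
have [|N' NP'] := gk t (e / 2); first by rewrite divr_gt0.
have tt : 0 <= t <= t by rewrite t0 lexx.
have h1 := NP _ (leq_maxl N N') _ tt; have h2 := NP' _ (leq_maxr N N') _ tt.
rewrite (_ : h t - k t = (g (maxn N N') t - k t) - (g (maxn N N') t - h t)); last by ring.
by apply: le_trans (cnrmB _ _) _; lra.
Qed.

Lemma ucvg_unique (g : nat -> Cplus R) h k : ucvg g h -> ucvg g k -> h = k.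
Proof. by move=> gh gk; apply: Cplus_ext => t t0; exact: ucvg_pt gh gk. Qed.

(** On [[0, T]] the difference is at most [K d t], where [K] bounds [f] and [d] bounds [g n - h].
    This continuity carries identities between partial sums over to limits. *)
Lemma ucvg_conv f (g : nat -> Cplus R) h : ucvg g h ->
  ucvg (fun n => conv f (g n)) (conv f h).
Proof.
move=> gh T e e0; have [K K0 fK] := cnrm_bounded f T.
pose d := e / (K * `|T| + 1).
have p : 0 < K * `|T| + 1 by rewrite ltr_pwDr// mulr_ge0.
have [|N NP] := gh T d; first by rewrite divr_gt0.
exists N => n nN t tT; rewrite -CplusB -convBr.
apply: le_trans (@cnrm_conv_le_cst f (g n - h) K d T t tT fK _) _.
  by move=> u uT; rewrite CplusB; exact: NP.
have d0 : 0 <= d by rewrite divr_ge0// ltW.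
apply: (@le_trans _ _ (d * (K * `|T| + 1))); last by rewrite divfK// gt_eqF.
rewrite [K * d]mulrC -mulrA ler_wpM2l//.
have tT' : t <= `|T| by apply: le_trans (ler_norm T); case/andP: tT.
by apply: le_trans (ler_wpM2l K0 tT') _; rewrite lerDl.
Qed.

Lemma ucvg_shift (g : nat -> Cplus R) h : ucvg g h -> ucvg (fun n => g n.+1) h.
Proof. by move=> gh T e e0; have [N NP] := gh T e e0; exists N => n nN; apply: NP; lia. Qed.

Lemma ucvgBr (g : nat -> Cplus R) h k : ucvg g h -> ucvg (fun n => g n - k) (h - k).
Proof.
move=> gh T e e0; have [N NP] := gh T e e0; exists N => n nN t tT.
by rewrite (_ : _ - _ = g n t - h t); [exact: NP|rewrite !CplusB; ring].
Qed.

Fact mon_subproof c n : {within `[0, +oo[, continuous (cmonomial c n : R -> R[i]^o)}.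
Proof. by apply: continuous_subspaceT; exact: ccont_cmonomial. Qed.

Definition monomial (c : R[i]) n : Cplus R := of_cont (@mon_subproof c n).

Lemma monomialE c n t : 0 <= t -> monomial c n t = cmonomial c n t.
Proof. by move=> t0; rewrite /= max_r. Qed.

Lemma monomial0 c : monomial c 0 = Ccst c.
Proof.
by apply: Cplus_ext => t t0; rewrite monomialE// /cmonomial expr0 fact0 divr1 mulr1.
Qed.

Lemma conv_monomial c d n : conv (Ccst c) (monomial d n) = monomial (c * d) n.+1.
Proof.
apply: Cplus_ext => t t0; rewrite conv_cst monomialE//.
rewrite (@eq_cint _ _ (cmonomial d n)); last by move=> u /andP[u0 _]; rewrite monomialE.
by rewrite cint_cmonomial// /cmonomial mulrA.
Qed.

Lemma CtwistE alpha f t : 0 <= t -> Ctwist alpha f t = cexpt alpha t * f t.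
Proof. by move=> t0; rewrite /= max_r. Qed.

Lemma CderE f t : 0 <= t -> Cder f t = - t%:C%C * f t.
Proof. by move=> t0; rewrite /= max_r. Qed.

Lemma Ctwist_conv alpha f g :
  Ctwist alpha (conv f g) = conv (Ctwist alpha f) (Ctwist alpha g).
Proof.
apply: Cplus_ext => t t0; rewrite CtwistE// !convE -cintZ; last exact: ccont_conv.
apply: eq_cint => u /andP[u0 ut]; rewrite !CtwistE//; last by rewrite subr_ge0.
have -> : cexpt alpha t = cexpt alpha (t - u) * cexpt alpha u by rewrite -cexptD subrK.
ring.
Qed.

(** The integral equation of [c e^(alpha t)]; for [c = 1] it becomes the equation for [T l] in
    [Q]. *)
Lemma Ctwist_cst (alpha c : R[i]) :
  Ctwist alpha (Ccst c) = Ccst c + conv (Ccst alpha) (Ctwist alpha (Ccst c)).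
Proof.
apply: Cplus_ext => t t0; rewrite CplusD conv_cst CtwistE//.
rewrite (@eq_cint _ _ (fun u => c * cexpt alpha u)); last first.
  by move=> u /andP[u0 _]; rewrite CtwistE// mulrC.
rewrite cintZ; last exact: ccont_cexpt.
by rewrite mulrCA cint_cexpt// !CcstE; ring.
Qed.

Lemma CtwistB alpha f g : Ctwist alpha (f - g) = Ctwist alpha f - Ctwist alpha g.
Proof. by apply: Cplus_ext => t t0; rewrite CplusB !CtwistE// CplusB mulrBr. Qed.

Lemma Ctwist0 alpha : Ctwist alpha (0 : Cplus R) = 0.
Proof. by apply: Cplus_ext => t t0; rewrite CtwistE// Cplus0 mulr0. Qed.

Lemma CtwistK alpha f : Ctwist (- alpha) (Ctwist alpha f) = f.
Proof.
apply: Cplus_ext => t t0; rewrite !CtwistE// mulrA -cexptDl addNr cexpt0l.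
by rewrite mul1r.
Qed.

Lemma CderD f g : Cder (f + g) = Cder f + Cder g.
Proof. by apply: Cplus_ext => t t0; rewrite CplusD !CderE// CplusD mulrDr. Qed.

Lemma Cder_conv f g : Cder (conv f g) = conv (Cder f) g + conv f (Cder g).
Proof.
apply: Cplus_ext => t t0; rewrite CplusD CderE// !convE -cintZ; last exact: ccont_conv.
rewrite -cintD; try exact: ccont_conv.
apply: eq_cint => u /andP[u0 ut]; rewrite !CderE//; last by rewrite subr_ge0.
by rewrite raddfB /=; ring.
Qed.

Lemma Cder_cst (c : R[i]) : Cder (Ccst c) = - conv (Ccst 1) (Ccst c).
Proof.
apply: Cplus_ext => t t0; rewrite -[RHS]/(- (conv (Ccst 1) (Ccst c) t)) -monomial0.
rewrite conv_monomial CderE// !monomialE// /cmonomial expr0 fact0 divr1 mulr1 mul1r.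
by rewrite expr1 factS fact0 muln1 divr1 mulNr mulrC.
Qed.
End Convolution.

(** * The entire function attached to a convergent series *)

Section Borel.
Variable R : realType.
Implicit Types (a b : nat -> R[i]) (C M t T : R).
Local Notation conv := Defs.conv.

Lemma cnrm_cmonomial (c : R[i]) n t : cnrm (cmonomial c n t) <= cnrm c * (`|t| ^+ n / n`!%:R).
Proof.
apply: le_trans (cnrmM _ _) _; rewrite cnrm_real normrM normrX normfV.
by rewrite (@ger0_norm _ n`!%:R).
Qed.

Lemma expc_summable C (x : R) : summable_nat (fun n => C * exp_coeff x n).
Proof. by apply: summable_natZ; exact: is_cvg_series_exp_coeff. Qed.

Lemma expc_lim C (x : R) : rlim (series (fun n => C * exp_coeff x n)) = C * expR x.
Proof.
exact: (lim_seriesZ C (is_cvg_series_exp_coeff x)).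
Qed.

Lemma cmonomial_dom C M a t T n : geo_bounded C M a -> `|t| <= T ->
  cnrm (cmonomial (a n) n t) <= C * exp_coeff (M * T) n.
Proof.
move=> [C0 M0 aM] tT; apply: le_trans (cnrm_cmonomial _ _ _) _.
have T0 : 0 <= T by apply: le_trans tT.
have -> : C * exp_coeff (M * T) n = (C * M ^+ n) * (T ^+ n / n`!%:R).
  by rewrite /exp_coeff /= exprMn; ring.
apply: ler_pM; rewrite ?cnrm_ge0 ?aM ?divr_ge0 ?exprn_ge0//.
by rewrite ler_wpM2r ?invr_ge0// lerXn2r ?nnegrE.
Qed.

Definition borel_fun a t : R[i] := csum (fun n => cmonomial (a n) n t).

Lemma borel_fun_sums C M a t : geo_bounded C M a ->
  sums_to (fun n => cmonomial (a n) n t) (borel_fun a t).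
Proof.
move=> aM.
exact: (csum_sums (@expc_summable C (M * `|t|)) (fun n => cmonomial_dom n aM (lexx _))).
Qed.

Lemma borel_fun_tail C M a T e : geo_bounded C M a -> 0 < e ->
  exists N, forall n, (N <= n)%N -> forall t, `|t| <= T ->
  cnrm (series (fun n => cmonomial (a n) n t) n - borel_fun a t) <= e.
Proof.
move=> aM e0; have e2 : 0 < e / 2 by rewrite divr_gt0.
have := (cvgrPdist_le _ _).1 (summable_nat_tail (@expc_summable C (M * T))) _ e2.
move=> [N _ NP]; exists N => n /NP /=; rewrite sub0r normrN => h t tT.
rewrite -cnrmN opprB.
apply: le_trans (csum_tail (@expc_summable C (M * T)) (fun k => cmonomial_dom k aM tT) n) _.
by move: h => /ler_normlP[_ h]; lra.
Qed.

(** The usual argument with [e / 3]. Convergence is uniform on bounded sets only; the radius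
    [|x| + 1] leaves room for a neighbourhood of [x]. *)
Lemma continuous_unif_limit (f : R -> R) (g : nat -> R -> R) :
  (forall n, continuous (g n)) ->
  (forall T e, 0 < e -> exists n, forall t, `|t| <= T -> `|g n t - f t| <= e) ->
  continuous f.
Proof.
move=> cg gf x; apply/cvgrPdist_le => e e0.
have [|n nP] := gf (`|x| + 1) (e / 3); first by rewrite divr_gt0.
have e3 : 0 < e / 3 by rewrite divr_gt0.
have := (cvgrPdist_le _ _).1 (cg n x) _ e3.
have x1 : \forall t \near x, `|x - t| <= 1.
  have cx : id t @[t --> x] --> x by exact: cvg_id.
  exact: ((cvgrPdist_le _ _).1 cx 1 ltr01).
move=> h; near=> t.
have h1 : `|g n x - g n t| <= e / 3 by near: t; exact: h.
have h2 : `|g n x - f x| <= e / 3 by apply: nP; rewrite lerDl.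
have h3 : `|g n t - f t| <= e / 3.
  apply: nP; have : `|x - t| <= 1 by near: t; exact: x1.
  by move=> xt; rewrite (_ : t = x - (x - t)); [apply: le_trans (ler_normB _ _) _; lra|ring].
rewrite (_ : f x - f t = - (g n x - f x) + (g n x - g n t) + (g n t - f t)); last by ring.
apply: le_trans (ler_normD _ _) _.
apply: le_trans (lerD (ler_normD _ _) (lexx _)) _; rewrite normrN; lra.
Unshelve. all: by end_near. Qed.

Lemma ccont_series a n :
  continuous ((fun t => series (fun k => cmonomial (a k) k t) n) : R -> R[i]^o).
Proof.
elim: n => [|n IH].
  rewrite (_ : (fun t => _) = (fun=> 0)); first exact: (@ccont_cst _ 0).
  by apply/funext => t; rewrite seriesEnat /= big_geq.
rewrite (_ : (fun t => _) = (fun t => series (fun k => cmonomial (a k) k t) n + cmonomial (a n) n t)).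
  by apply: ccontD; [exact: IH|exact: ccont_cmonomial].
by apply/funext => t; rewrite seriesEnat /= big_nat_recr.
Qed.

Lemma ccont_borel_fun C M a : geo_bounded C M a -> continuous (borel_fun a : R -> R[i]^o).
Proof.
move=> aM.
rewrite (_ : borel_fun a = (fun t => (complex.Re (borel_fun a t) +i* complex.Im (borel_fun a t))%C)); last first.
  by apply/funext => t; case: (borel_fun a t).
apply: complex_continuous.
- apply: (@continuous_unif_limit _ (fun n t => complex.Re (series (fun k => cmonomial (a k) k t) n))).
    by move=> n; apply: continuous_Re; exact: ccont_series.
  move=> T e e0; have [N NP] := borel_fun_tail T aM e0; exists N => t tT.
  by apply: le_trans (NP N (leqnn _) t tT); rewrite -raddfB /cnrm lerDl.
- apply: (@continuous_unif_limit _ (fun n t => complex.Im (series (fun k => cmonomial (a k) k t) n))).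
    by move=> n; apply: continuous_Im; exact: ccont_series.
  move=> T e e0; have [N NP] := borel_fun_tail T aM e0; exists N => t tT.
  by apply: le_trans (NP N (leqnn _) t tT); rewrite -raddfB /cnrm lerDr.
Qed.

(* [sum_n a_n t^n / n!], so that [sum_n a_n l^n = s {borel a}]. *)
Definition borel a : Cplus R :=
  xget 0 [set f : Cplus R | forall t, 0 <= t -> f t = borel_fun a t].

Lemma borelE a t : convergent_series a -> 0 <= t -> borel a t = borel_fun a t.
Proof.
move=> /convergent_geo[C [M aM]] t0; rewrite /borel; case: xgetP => [f _ -> //|].
have cf : {within `[0, +oo[, continuous (borel_fun a : R -> R[i]^o)}.
  exact/continuous_subspaceT/(ccont_borel_fun aM).
by move=> /(_ (of_cont cf))[] t' t'0; rewrite /= max_r.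
Qed.

Lemma borel_sums a t : convergent_series a -> 0 <= t ->
  sums_to (fun n => cmonomial (a n) n t) (borel a t).
Proof.
move=> ca t0; rewrite borelE//; have [C [M aM]] := convergent_geo ca.
exact: borel_fun_sums aM.
Qed.

Definition borel_sum a n : Cplus R := \sum_(0 <= k < n) monomial (a k) k.

Lemma borel_sumS a n : borel_sum a n.+1 = borel_sum a n + monomial (a n) n.
Proof. by rewrite /borel_sum big_nat_recr. Qed.

Lemma borel_sumE a n t : 0 <= t ->
  borel_sum a n t = series (fun k => cmonomial (a k) k t) n.
Proof.
move=> t0; elim: n => [|n IH].
  by rewrite /borel_sum seriesEnat /= !big_geq.
rewrite borel_sumS CplusD IH monomialE//.
by rewrite !seriesEnat /= big_nat_recr.
Qed.

Lemma borel_ucvg a : convergent_series a -> ucvg (borel_sum a) (borel a).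
Proof.
move=> ca T e e0; have [C [M aM]] := convergent_geo ca.
have [N NP] := borel_fun_tail T aM e0; exists N => n nN t /andP[t0 tT].
by rewrite borel_sumE// borelE//; apply: NP => //; rewrite ger0_norm.
Qed.

(** Linear in [C], with a factor that depends only on [M] and [T]: the form of bound that
    [defect_eq0] asks for. *)
Lemma borel_le C M a t T : geo_bounded C M a -> 0 <= t <= T ->
  cnrm (borel a t) <= 2 * expR (M * T) * C.
Proof.
move=> aM /andP[t0 tT]; rewrite borelE//; last exact: geo_convergent aM.
have tT' : `|t| <= T by rewrite ger0_norm.
apply: le_trans (csum_le (@expc_summable C (M * T)) (fun k => cmonomial_dom k aM tT')) _.
by rewrite expc_lim -mulrA [C * _]mulrC.
Qed.

Lemma cvs_tail a : convergent_series a -> convergent_series (seq_tail a).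
Proof. by move=> /convergent_geo[C [M /geo_tail aM]]; exact: geo_convergent aM. Qed.

Lemma cvs_mobius alpha a : convergent_series a -> convergent_series (mobius alpha a).
Proof. by move=> /convergent_geo[C [M /(geo_mobius alpha) aM]]; exact: geo_convergent aM. Qed.

Lemma cvsD a b : convergent_series a -> convergent_series b ->
  convergent_series (fun n => a n + b n).
Proof.
move=> /convergent_geo[C [M [C0 M0 aM]]] /convergent_geo[C' [M' [C'0 M'0 bM]]].
apply: (@geo_convergent _ (C + C') (M + M')); split=> [||n]; rewrite ?addr_ge0//.
apply: le_trans (cnrmD _ _) _; rewrite mulrDl; apply: lerD.
  apply: le_trans (aM n) _.
  by rewrite ler_wpM2l// lerXn2r ?nnegrE ?addr_ge0// lerDl.
apply: le_trans (bM n) _.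
by rewrite ler_wpM2l// lerXn2r ?nnegrE ?addr_ge0// lerDr.
Qed.

Lemma cvsZ (c : R[i]) a : convergent_series a -> convergent_series (fun n => c * a n).
Proof.
move=> /convergent_geo[C [M [C0 M0 aM]]].
apply: (@geo_convergent _ (cnrm c * C) M); split=> // [|n].
  by rewrite mulr_ge0 ?cnrm_ge0.
by apply: le_trans (cnrmM _ _) _; rewrite -mulrA ler_wpM2l ?cnrm_ge0.
Qed.

(** Exact for partial sums, where the left side runs one index ahead, and preserved by the limit.
    Divided by [l], it is [S a = a_0 + l S a']. *)
Lemma borel_rec a : convergent_series a ->
  borel a - Ccst (a 0%N) = conv (Ccst 1) (borel (seq_tail a)).
Proof.
move=> ca; apply: ucvg_unique (ucvgBr _ (ucvg_shift (borel_ucvg ca))) _.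
have := ucvg_conv (Ccst 1) (borel_ucvg (cvs_tail ca)).
congr ucvg; apply/funext => n; elim: n => [|n IH].
  rewrite /borel_sum big_geq// big_nat1 monomial0 subrr.
  exact: convr0.
rewrite [borel_sum (seq_tail a) _]borel_sumS convDr IH conv_monomial mul1r.
by rewrite [in RHS]borel_sumS addrAC.
Qed.

Lemma borelD a b : convergent_series a -> convergent_series b ->
  borel (fun n => a n + b n) = borel a + borel b.
Proof.
move=> ca cb; apply: Cplus_ext => t t0; rewrite CplusD.
apply: sums_to_unique (borel_sums (cvsD ca cb) t0) _.
rewrite (_ : (fun n => _) = (fun n => cmonomial (a n) n t + cmonomial (b n) n t)).
  by apply: sums_toD; exact: borel_sums.
by apply/funext => n; rewrite /cmonomial mulrDl.
Qed.

Lemma borelZ (c : R[i]) a t : convergent_series a -> 0 <= t ->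
  borel (fun n => c * a n) t = c * borel a t.
Proof.
move=> ca t0; apply: sums_to_unique (borel_sums (cvsZ c ca) t0) _.
rewrite (_ : (fun n => _) = (fun n => c * cmonomial (a n) n t)).
  by apply: sums_toZ; exact: borel_sums.
by apply/funext => n; rewrite /cmonomial mulrA.
Qed.

(** In [Q] the scalar [c] is the constant function divided by [l]; the scalar rule is therefore
    stated after convolution with [l]. *)
Lemma conv_borelZ (c : R[i]) a : convergent_series a ->
  conv (Ccst 1) (borel (fun n => c * a n)) = conv (Ccst c) (borel a).
Proof.
move=> ca; apply: Cplus_ext => t t0; rewrite !conv_cst mul1r -cintZ; last exact: ccont_Cplus.
by apply: eq_cint => u /andP[u0 _]; rewrite borelZ.
Qed.

(** The coefficients of [- t f(t)], hence of [d/ds] applied to [l S a]; the derivative of [S a]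
    itself has [lder_coef]. *)
Definition der_coef a (n : nat) : R[i] := if n is m.+1 then - n%:R * a m else 0.

(** The factor [n + 1] is absorbed by [2^(n+1)]; [M + 1] replaces [M] so that [M^n <= (M + 1)^(n+1)]
    despite the index shift. *)
Lemma cvs_der a : convergent_series a -> convergent_series (der_coef a).
Proof.
move=> /convergent_geo[C [M [C0 M0 aM]]].
have M1 : 0 <= M + 1 by rewrite addr_ge0.
apply: (@geo_convergent _ C (2 * (M + 1))); split=> // [|[|n]]; first exact: mulr_ge0.
  by rewrite cnrm0 expr0 mulr1.
apply: le_trans (cnrmM _ _) _; rewrite cnrmN -(rmorph_nat (real_complex R)) cnrm_real.
rewrite normr_nat exprMn mulrCA; apply: ler_pM; rewrite ?cnrm_ge0//.
  by rewrite -natrX ler_nat ltnW// ltn_expl.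
apply: le_trans (aM n) _; rewrite ler_wpM2l//.
apply: (@le_trans _ _ ((M + 1) ^+ n)); first by rewrite lerXn2r ?nnegrE// lerDl.
by rewrite exprS ler_peMl ?exprn_ge0// lerDr.
Qed.

Lemma Cder_borel a : convergent_series a -> Cder (borel a) = borel (der_coef a).
Proof.
move=> ca; apply: Cplus_ext => t t0; rewrite CderE//.
apply: sums_to_unique (borel_sums (cvs_der ca) t0).
have -> : - t%:C%C * borel a t = cmonomial (der_coef a 0) 0 t + - t%:C%C * borel a t.
  by rewrite /cmonomial mul0r add0r.
apply: (@sums_toS _ (fun n => cmonomial (der_coef a n) n t)).
rewrite (_ : (fun n => _) = (fun n => - t%:C%C * cmonomial (a n) n t)).
  by apply: sums_toZ; exact: borel_sums.
apply/funext => n; rewrite /cmonomial /der_coef.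
have n0 : n`!%:R != 0 :> R by rewrite pnatr_eq0 -lt0n fact_gt0.
have e : - t * (t ^+ n / n`!%:R) = - n.+1%:R * (t ^+ n.+1 / n.+1`!%:R).
  by rewrite factS natrM exprS; field; rewrite n0 nat1r pnatr_eq0.
have -> : - t%:C%C * (a n * (t ^+ n / n`!%:R)%:C%C) = a n * (- t * (t ^+ n / n`!%:R))%:C%C.
  by rewrite (rmorphM (real_complex R) (- t)) (rmorphN (real_complex R)); ring.
rewrite e (rmorphM (real_complex R) (- n.+1%:R)) (rmorphN (real_complex R)).
by rewrite (rmorph_nat (real_complex R)); ring.
Qed.
End Borel.

(** * Formal Laurent series: substitution, derivation and the Cauchy product *)

Section LaurentTheory.
Variable K : fieldType.
Implicit Types (f g h : laurent K) (a b : nat -> K).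

Lemma coefLD f g n : (f + g) n = f n + g n.
Proof. by []. Qed.

Lemma coefLB f g n : (f - g) n = f n - g n.
Proof. by []. Qed.

Lemma coefLconst (c : K) n : lconst c n = if n == 0 then c else 0.
Proof. by []. Qed.

(** The sums range over all integers, but a common finite box contains the support, so the exchange
    is that of finite sums. *)
Lemma fsum_exchange (F : int -> int -> K) B :
  (forall i j, i \notin box B \/ j \notin box B -> F i j = 0) ->
  \sum_(i \in [set: int]) \sum_(j \in [set: int]) F i j =
  \sum_(j \in [set: int]) \sum_(i \in [set: int]) F i j.
Proof.
move=> F0; rewrite (@fsum_box _ B); last first.
  by move=> i iB; rewrite fsbig1// => j _; apply: F0; left.
rewrite [RHS](@fsum_box _ B); last first.
  by move=> j jB; rewrite fsbig1// => i _; apply: F0; right.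
transitivity (\sum_(i <- box B) \sum_(j <- box B) F i j).
  by apply: eq_bigr => i _; rewrite (@fsum_box _ B)// => j jB; apply: F0; right.
rewrite exchange_big /=; apply: eq_bigr => j _.
by rewrite (@fsum_box _ B)// => i iB; apply: F0; left.
Qed.

Lemma fsum_shift (F : int -> K) k :
  \sum_(i \in [set: int]) F i = \sum_(i \in [set: int]) F (i + k).
Proof.
rewrite (@reindex_fsbigT _ _ _ _ _ (fun i => i + k))//.
by exists (fun i => i - k) => i; lia.
Qed.

Section Subst.
Variable alpha : K.
Let w := lmob alpha.

Lemma lsubstE f m : lsubst alpha f m = \sum_(n \in [set: int]) f n * (w ^ n) m.
Proof. by []. Qed.

Lemma vanish_lsubst f N : (forall n, n < N -> f n = 0) ->
  forall n, n < N -> lsubst alpha f n = 0.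
Proof.
move=> fN m mN; rewrite lsubstE fsbig1// => n _.
have [nm|mn] := ltP m n; first by rewrite vanish_lmob ?mulr0.
by rewrite fN ?mul0r//; lia.
Qed.

Lemma lmob_neq0 : w != 0.
Proof.
have n0 n : lX K n = if n == 1 then 1 else 0 by [].
rewrite mulf_neq0 ?invr_eq0//.
  apply/eqP => /(congr1 (fun f : laurent K => f 1)); rewrite n0 /= => /eqP.
  by rewrite -[X in _ == X]/(0 : K) oner_eq0.
apply/eqP => /(congr1 (fun f : laurent K => f 0)); rewrite coefL_sub /= subr0 => /eqP.
by rewrite -[X in _ == X]/(0 : K) oner_eq0.
Qed.

Lemma lmobE : (1 - lconst alpha * lX K) * w = lX K.
Proof.
have u0 : 1 - lconst alpha * lX K != 0.
  by apply: contra_neq lmob_neq0 => e; rewrite /w /lmob e invr0 mulr0.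
by rewrite /w /lmob mulrCA mulfV// mulr1.
Qed.

Lemma lsubst_mul f h m : (lsubst alpha f * h) m =
  \sum_(n \in [set: int]) f n * (w ^ n * h) m.
Proof.
have [N fN] := laurent_bounded_nat f; have [M hM] := laurent_bounded_nat h.
rewrite coefLM.
under eq_fsbigr do rewrite lsubstE mulr_fsuml.
under [RHS]eq_fsbigr do rewrite coefLM mulr_fsumr.
rewrite (@fsum_exchange _ (N + M + absz m)).
  by apply: eq_fsbigr => n _; apply: eq_fsbigr => p _; rewrite mulrA.
(* A nonzero term needs [- N <= n <= p <= m + M]; the middle inequality is [vanish_lmob]. *)
move=> p n pn.
have [nN|nN] := ltP n (- N%:Z); first by rewrite fN ?mul0r.
have [pn'|pn'] := ltP p n; first by rewrite vanish_lmob ?mulr0 ?mul0r.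
have [jM|jM] := ltP (m - p) (- M%:Z); first by rewrite hM ?mulr0.
by exfalso; move: pn; rewrite !mem_box; lia.
Qed.

(** Both sides expand into the double sum of [f_i g_(j-i) w^j]. The reindexing uses
    [w^(j-i) w^i = w^j] for integer exponents, hence [w != 0]. *)
Lemma lsubstM f g : lsubst alpha (f * g) = lsubst alpha f * lsubst alpha g.
Proof.
have [N fN] := laurent_bounded_nat f; have [M gM] := laurent_bounded_nat g.
apply: laurentE => m; rewrite lsubst_mul lsubstE.
have E i : (w ^ i * lsubst alpha g) m = \sum_(j \in [set: int]) g (j - i) * (w ^ j) m.
  rewrite mulrC lsubst_mul (fsum_shift _ (- i)); apply: eq_fsbigr => j _.
  by rewrite -expfzDr ?lmob_neq0// subrK.
under [RHS]eq_fsbigr do rewrite E mulr_fsumr.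
under [LHS]eq_fsbigr do rewrite coefLM mulr_fsuml.
rewrite (@fsum_exchange _ (N + M + absz m)).
  by apply: eq_fsbigr => n _; apply: eq_fsbigr => p _; rewrite mulrA.
move=> n i ni.
have [iN|iN] := ltP i (- N%:Z); first by rewrite fN ?mul0r.
have [mn|mn] := ltP m n; first by rewrite vanish_lmob ?mulr0.
have [jM|jM] := ltP (n - i) (- M%:Z); first by rewrite gM ?mulr0 ?mul0r.
by exfalso; move: ni; rewrite !mem_box; lia.
Qed.

Lemma lsubstB f g : lsubst alpha (f - g) = lsubst alpha f - lsubst alpha g.
Proof.
have [N fN] := laurent_bounded_nat f; have [M gM] := laurent_bounded_nat g.
apply: laurentE => m; rewrite coefLB !lsubstE.
have H (F : laurent K) B i : (forall n : int, n < - B%:Z -> F n = 0) ->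
    (B <= N + M + absz m)%N ->
    i \notin box (N + M + absz m) -> F i * (w ^ i) m = 0.
  rewrite mem_box => FB BB ib; have [iN|iN] := ltP i (- B%:Z); first by rewrite FB ?mul0r.
  by rewrite vanish_lmob ?mulr0//; lia.
rewrite !(@fsum_box _ (N + M + absz m)).
- by rewrite -sumrB; apply: eq_bigr => i _; rewrite -mulrBl.
- by move=> i; apply: (H g M) => //; lia.
- by move=> i; apply: (H f N) => //; lia.
- by move=> i iB; rewrite coefLB mulrBl (H f N)// ?(H g M) ?subr0//; lia.
Qed.

Lemma lsubst_const c : lsubst alpha (lconst c) = lconst c.
Proof.
apply: laurentE => m; rewrite lsubstE (fsbigE [:: 0])//=.
  by rewrite big_cons big_nil mem_set//= addr0; case: eqP; rewrite ?mulr1 ?mulr0.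
by move=> i _; rewrite inE => /negbTE ->; rewrite mul0r.
Qed.

Lemma lsubst_X : lsubst alpha (lX K) = w.
Proof.
apply: laurentE => m; rewrite lsubstE (fsbigE [:: 1])//=.
  by rewrite big_cons big_nil mem_set//= addr0 mul1r.
by move=> i _; rewrite inE => /negbTE ->; rewrite mul0r.
Qed.

Lemma lsubst1 : lsubst alpha 1 = 1.
Proof. exact: lsubst_const. Qed.

Lemma lsubst0 : lsubst alpha 0 = 0.
Proof. by rewrite -{1}(subrr 0) lsubstB subrr. Qed.

Lemma lsubstD f g : lsubst alpha (f + g) = lsubst alpha f + lsubst alpha g.
Proof. by rewrite -{1}[g]opprK -[- g]sub0r !lsubstB lsubst0 sub0r opprK. Qed.

Lemma lsubst_eq0 f : lsubst alpha f = 0 -> f = 0.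
Proof.
move=> Tf; apply/eqP/negP => /negP f0.
have : lsubst alpha (f^-1 * f) = 0 by rewrite lsubstM Tf mulr0.
by rewrite mulVf// lsubst1 => /eqP; rewrite oner_eq0.
Qed.

Lemma lsubst_inj : injective (lsubst alpha).
Proof.
move=> f g /eqP; rewrite -subr_eq0 -lsubstB => /eqP/lsubst_eq0/eqP.
by rewrite subr_eq0 => /eqP.
Qed.
End Subst.

Lemma lderD f g : lder (f + g) = lder f + lder g.
Proof. by apply: laurentE => n; rewrite coefLD /= mulrDr. Qed.

(** Once the first sum on the right is shifted by one, all terms are multiples of [f_i g_(m-1-i)],
    and [m - 1 = i + (m - 1 - i)]. *)
Lemma lderM f g : lder (f * g) = lder f * g + f * lder g.
Proof.
have [N fN] := laurent_bounded_nat f; have [M gM] := laurent_bounded_nat g.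
apply: laurentE => m; rewrite coefLD -[LHS]/(- (m - 1)%:~R * (f * g) (m - 1)).
rewrite !coefLM [X in _ = X + _](fsum_shift _ 1) /=.

under [X in _ = _ + X]eq_fsbigr do rewrite [m - _ - 1]addrAC.
have e i : m - (i + 1) = m - 1 - i by lia.
under [X in _ = X + _]eq_fsbigr do rewrite e addrK.
have H i : i \notin box (N + M + absz (m - 1)) -> f i = 0 \/ g (m - 1 - i) = 0.
  rewrite mem_box => iB.
  have [iN|iN] := ltP i (- N%:Z); first by left; rewrite fN.
  by right; rewrite gM//; lia.
rewrite !(@fsum_box _ (N + M + absz (m - 1))).
- rewrite mulr_sumr -big_split /=; apply: eq_bigr => i _.
  rewrite (_ : (m - 1)%:~R = i%:~R + (m - 1 - i)%:~R :> K); last by rewrite -rmorphD subrKC.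
  by ring.
- by move=> i /H[->|->]; rewrite ?mulr0 ?mul0r.
- by move=> i /H[->|->]; rewrite ?mulr0 ?mul0r.
- by move=> i /H[->|->]; rewrite ?mulr0 ?mul0r.
Qed.

Lemma lseries_rec a :
  lseries a = lconst (a 0%N) + lX K * lseries (fun n => a n.+1).
Proof.
apply: laurentE => -[[|n]|n]; rewrite coefLD coefLconst coefLXM.
- by rewrite /= addr0.
- by rewrite (_ : n.+1%:Z - 1 = n)// ?add0r//; lia.
- by rewrite (_ : Negz n - 1 = Negz n.+1) ?addr0//; lia.
Qed.

Lemma lseries_neg a (n : int) : n < 0 -> lseries a n = 0.
Proof. by case: n. Qed.

Lemma lseriesD a b : lseries (fun n => a n + b n) = lseries a + lseries b.
Proof. by apply: laurentE => -[n|n]; rewrite coefLD //= addr0. Qed.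

Lemma lseries_inj a b : lseries a = lseries b -> a = b.
Proof. by move=> e; apply/funext => n; have := congr1 (fun f : laurent K => f n) e. Qed.

(** The usual Cauchy product, written as [A B = a_0 B + X A' B] so that it fits the head-and-tail
    recursion. *)
Fixpoint cauchy_prod a b (n : nat) : K :=
  a 0%N * b n + (if n is m.+1 then cauchy_prod (fun k => a k.+1) b m else 0).

Lemma lseriesM a b : lseries (cauchy_prod a b) = lseries a * lseries b.
Proof.
have neg c n : n < 0 -> (lseries c * lseries b) n = 0.
  by move=> n0; apply: (@vanish_mul _ _ _ 0 0 _ _ n) => // k; exact: lseries_neg.
apply: laurentE => -[n|n]; last by rewrite neg.
rewrite -[LHS]/(cauchy_prod a b n); elim: n a => [|n IH] a; rewrite lseries_rec mulrDl coefLD coefLCM -mulrA coefLXM.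
  by rewrite neg.
rewrite -[LHS]/(_ + cauchy_prod _ b n) IH.
by rewrite (_ : n.+1%:Z - 1 = n)//; lia.
Qed.

Lemma lseries_der a : lseries (fun n => if n is m.+1 then - m%:R * a m else 0) = lder (lseries a).
Proof.
apply: laurentE => -[[|n]|n].
- by rewrite /= mulr0.
- rewrite -[RHS]/(- (n.+1%:Z - 1)%:~R * lseries a (n.+1%:Z - 1)).
  by rewrite (_ : n.+1%:Z - 1 = n)//; lia.
- rewrite -[RHS]/(- (Negz n - 1)%:~R * lseries a (Negz n - 1)).
  by rewrite (lseries_neg a (n := Negz n - 1)) ?mulr0//; lia.
Qed.

End LaurentTheory.

(** Multiplying [X(c) = c_0 + w X(c')] by [1 - alpha l] removes [w]. The resulting relation
    expresses coefficient [n + 1] through coefficients [n] of [X(c')] and [X(c)], so induction on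
    [n] suffices. *)
Lemma lseries_mobius (R : realType) (alpha : R[i]) a :
  lseries (mobius alpha a) = lsubst alpha (lseries a).
Proof.
have neg c n : n < 0 -> lsubst alpha (lseries c) n = 0.
  by apply: vanish_lsubst => k; exact: lseries_neg.
have rec c : lsubst alpha (lseries c) =
    lconst (c 0%N) + lmob alpha * lsubst alpha (lseries (seq_tail c)).
  by rewrite {1}lseries_rec lsubstD lsubstM lsubst_const lsubst_X.
have rec' c : (1 - lconst alpha * lX _) * (lsubst alpha (lseries c) - lconst (c 0%N)) =
    lX _ * lsubst alpha (lseries (seq_tail c)).
  by rewrite {1}rec addrAC subrr add0r mulrA lmobE.
have rec2 c : lsubst alpha (lseries c) = lconst (c 0%N) +
    (lX _ * lsubst alpha (lseries (seq_tail c)) +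
     lconst alpha * (lX _ * (lsubst alpha (lseries c) - lconst (c 0%N)))).
  by rewrite -rec'; ring.
have coef (f g : laurent R[i]) c n : (lconst c + (lX _ * f + lconst alpha * (lX _ * g))) n =
    (if n == 0 then c else 0) + (f (n - 1) + alpha * g (n - 1)).
  by rewrite 2!coefLD (coefLCM alpha (lX _ * g)) (coefLXM f) (coefLXM g).
have rec3 c n : lsubst alpha (lseries c) n = (if n == 0 then c 0%N else 0) +
    (lsubst alpha (lseries (seq_tail c)) (n - 1) +
     alpha * (lsubst alpha (lseries c) (n - 1) - (if n - 1 == 0 then c 0%N else 0))).
  by rewrite {1}(rec2 c) coef coefLB coefLconst.
have B0 c : lsubst alpha (lseries c) 0 = c 0%N.
  by rewrite rec3 !(neg _ (0 - 1))// subr0 mulr0 !addr0.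
apply: laurentE => -[n|n]; last by rewrite neg.
rewrite -[LHS]/(mobius alpha a n); elim: n a => [|n IH] a; first by rewrite B0.
rewrite mobiusS IH (rec3 a) (_ : n.+1%:Z - 1 = n); last by lia.
rewrite add0r; congr (_ + _).
(* At [n = 0] the constant term subtracted in [rec3] cancels the coefficient, in agreement with the
   missing term of [mobiusS]. *)
case: n IH => [|n] IH; first by rewrite B0 subrr mulr0.
by rewrite subr0 IH.
Qed.

(** * The vanishing principle and bounds for Cauchy products *)

Section Vanishing.
Variable R : realType.
Implicit Types (a b : nat -> R[i]) (C M t T : R).
Local Notation conv := Defs.conv.

Lemma exp_coeff_cvg0 (c x : R) : (c * exp_coeff x n) @[n --> \oo] --> 0.
Proof. exact: cvg_series_cvg_0 (@expc_summable R c x). Qed.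

(* [F a] is then [l ^ n F (seq_tail^n a)], of size at most
   [K C (M t) ^ n / n!] at time [t]. *)
Lemma defect_eq0 (F : (nat -> R[i]) -> Cplus R) :
  (forall a, convergent_series a -> F a = conv (Ccst 1) (F (seq_tail a))) ->
  (forall M T, 0 <= M -> exists K, forall C a t,
     geo_bounded C M a -> 0 <= t <= T -> cnrm (F a t) <= K * C) ->
  forall a, convergent_series a -> F a = 0.
Proof.
move=> Frec Fle a /convergent_geo[C [M aM]]; apply: Cplus_ext => t t0.
(* [K] depends on [M] and [t] only, so it serves all the iterated tails of [a], which share [M]. *)
have [C0 M0 _] := aM; have [K KP] := Fle M t M0.
have bound n : forall c u, geo_bounded c M u -> forall s, 0 <= s <= t ->
    cnrm (F u s) <= (K * c * M ^+ n) * (s ^+ n / n`!%:R).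
  elim: n => [|n IH] c u uM s st.
    by rewrite !expr0 mulr1 fact0 divr1 mulr1; exact: KP uM st.
  rewrite Frec; last exact: geo_convergent uM.
  have h1 v : 0 <= v <= t -> cnrm (Ccst (1 : R[i]) v) <= 1 by rewrite CcstE cnrm1.
  have cb := @continuous_monomial R (K * (c * M) * M ^+ n) n.
  apply: le_trans (cnrm_conv_le st cb h1 (IH _ _ (geo_tail uM))) _.
  have s0 : 0 <= s by case/andP: st.
  have -> : K * c * M ^+ n.+1 = 1 * (K * (c * M) * M ^+ n) by rewrite exprS; ring.
  by rewrite -rint_monomial// le_eqVlt; apply/orP; left; apply/eqP;
    apply: eq_Rintegral => v _; rewrite mulrA.
apply: cnrm_eq0; apply: (@le_small_eq0 _ _ (fun n => (K * C) * exp_coeff (M * t) n)).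
  exact: exp_coeff_cvg0.
move=> n; have tt : 0 <= t <= t by rewrite t0 lexx.
apply: le_trans (bound n _ _ aM _ tt) _.
by rewrite /exp_coeff /= exprMn le_eqVlt; apply/orP; left; apply/eqP; ring.
Qed.

(** The recursion gives [C C' M' (M + M')^n] for the head and [(C M) C' (M + M')^n] for the tail,
    which add up to the claim. *)
Lemma geo_cauchy C M C' M' a b : geo_bounded C M a -> geo_bounded C' M' b ->
  geo_bounded (C * C') (M + M') (cauchy_prod a b).
Proof.
move=> aM [C'0 M'0 bM]; have [C0 M0 _] := aM.
split=> [||n]; rewrite ?mulr_ge0 ?addr_ge0//.
elim: n C C0 a aM => [|n IH] C C0 a aM /=.
  rewrite addr0 expr0 mulr1; apply: le_trans (cnrmM _ _) _.
  have [_ _ /(_ 0%N)] := aM; have := bM 0%N; rewrite !expr0 !mulr1 => h1 h2.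
  by rewrite ler_pM ?cnrm_ge0.
apply: le_trans (cnrmD _ _) _; rewrite exprS mulrDl mulrDr addrC; apply: lerD.
  have := IH _ _ _ (geo_tail aM); rewrite mulr_ge0// => /(_ isT).
  by rewrite !mulrA [C * C' * M]mulrAC.
apply: le_trans (cnrmM _ _) _.
have [_ _ /(_ 0%N)] := aM; rewrite expr0 mulr1 => h.
apply: le_trans (ler_pM (cnrm_ge0 _) (cnrm_ge0 _) h (bM n.+1)) _.
rewrite exprS !mulrA ler_wpM2l ?mulr_ge0// lerXn2r ?nnegrE ?addr_ge0//.
by rewrite lerDr.
Qed.

Lemma cvs_cauchy a b : convergent_series a -> convergent_series b ->
  convergent_series (cauchy_prod a b).
Proof.
move=> /convergent_geo[C [M aM]] /convergent_geo[C' [M' bM]].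
exact: geo_convergent (geo_cauchy aM bM).
Qed.

Definition scons a (n : nat) : R[i] := if n is m.+1 then a m else 0.

Lemma cvs_scons a : convergent_series a -> convergent_series (scons a).
Proof.
move=> /convergent_geo[C [M [C0 M0 aM]]]; have M1 : 0 <= M + 1 by rewrite addr_ge0.
apply: (@geo_convergent _ C (M + 1)); split=> // -[|n] /=.
  by rewrite cnrm0 expr0 mulr1.
apply: le_trans (aM n) _; rewrite ler_wpM2l//.
apply: (@le_trans _ _ ((M + 1) ^+ n)); first by rewrite lerXn2r ?nnegrE// lerDl.
by rewrite exprS ler_peMl ?exprn_ge0// lerDr.
Qed.

End Vanishing.

(** * The operators and the limits in the field of fractions *)

Section FractionFieldTheory.
Variables (R : realType) (Q : fieldType) (iota : Cplus R -> Q).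
Hypothesis hQ : is_fraction_field iota.
Implicit Types (f g h : Cplus R) (x y q : Q) (a b : nat -> R[i]).
Local Notation conv := Defs.conv.
Local Notation l := (ell iota).
Local Notation cst := (Qcst iota).

Lemma embD : {morph iota : f g / f + g}.
Proof. by case: hQ. Qed.

Lemma embM : {morph iota : f g / conv f g >-> f * g}.
Proof. by case: hQ. Qed.

Lemma emb_inj : injective iota.
Proof. by case: hQ. Qed.

Lemma emb0 : iota 0 = 0.
Proof. by apply: (addIr (iota 0)); rewrite -embD !add0r. Qed.

Lemma embN f : iota (- f) = - iota f.
Proof. by apply: (addIr (iota f)); rewrite -embD !addNr emb0. Qed.

Lemma embB f g : iota (f - g) = iota f - iota g.
Proof. by rewrite embD embN. Qed.

Lemma emb_eq0 f : (iota f == 0) = (f == 0).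
Proof. by rewrite -emb0 (inj_eq emb_inj). Qed.

Lemma ell_neq0 : l != 0.
Proof.
rewrite emb_eq0; apply/eqP => /(congr1 (fun f : Cplus R => f 0)) /eqP.
by rewrite CcstE Cplus0 oner_eq0.
Qed.

Lemma fracP q : exists f g, g != 0 /\ q = iota f / iota g.
Proof. by case: hQ. Qed.

Lemma frac_reprP q : (frac_repr iota q).2 != 0 /\
  q = iota (frac_repr iota q).1 / iota (frac_repr iota q).2.
Proof.
apply: (@xgetPex _ (0, 0) [set fg : Cplus R * Cplus R | fg.2 != 0 /\ q = iota fg.1 / iota fg.2]).
by have [f [g]] := fracP q; exists (f, g).
Qed.

Lemma frac_eq f g F G : g != 0 -> G != 0 -> iota f / iota g = iota F / iota G ->
  conv f G = conv F g.
Proof.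
rewrite -(emb_eq0 g) -(emb_eq0 G) => g0 G0 /eqP; rewrite eqr_div// => /eqP e.
by apply: emb_inj; rewrite !embM e.
Qed.

Section Twist.
Variable alpha : R[i].
Local Notation T := (twist iota alpha).

Lemma Ctwist_eq0 f : (Ctwist alpha f == 0) = (f == 0).
Proof.
by apply/eqP/eqP => [Tf|->]; rewrite ?Ctwist0// -(CtwistK alpha f) Tf Ctwist0.
Qed.

(** [twist] uses a chosen representation; [Ctwist] preserves the cross-multiplied identity between
    two representations, so the choice does not matter. *)
Lemma twist_frac f g : g != 0 ->
  T (iota f / iota g) = iota (Ctwist alpha f) / iota (Ctwist alpha g).
Proof.
move=> g0; rewrite /twist; have := frac_reprP (iota f / iota g).
case: (frac_repr _ _) => F G /= [G0 /(frac_eq g0 G0) e].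
apply/eqP; rewrite eqr_div ?emb_eq0 ?Ctwist_eq0//.
by rewrite -!embM -!Ctwist_conv e.
Qed.

Lemma twist_iota f : T (iota f) = iota (Ctwist alpha f).
Proof.
have l0 := ell_neq0.
rewrite -[iota f](mulfK l0) -embM twist_frac -?emb_eq0// Ctwist_conv embM.
by rewrite mulfK// emb_eq0 Ctwist_eq0 -emb_eq0.
Qed.

Lemma twistM x y : T (x * y) = T x * T y.
Proof.
have [f [g [g0 ->]]] := fracP x; have [f' [g' [g'0 ->]]] := fracP y.
rewrite mulf_div -!embM !twist_frac//; last by rewrite -emb_eq0 embM mulf_neq0 ?emb_eq0.
by rewrite mulf_div !Ctwist_conv !embM.
Qed.

Lemma twistB x y : T (x - y) = T x - T y.
Proof.
have [f [g [g0 ->]]] := fracP x; have [f' [g' [g'0 ->]]] := fracP y.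
rewrite -mulNr addf_div ?emb_eq0// mulNr -!embM -embB !twist_frac//; last first.
  by rewrite -emb_eq0 embM mulf_neq0 ?emb_eq0.
rewrite -[- (_ / _)]mulNr addf_div ?emb_eq0 ?Ctwist_eq0//.
by rewrite mulNr CtwistB !Ctwist_conv embB !embM.
Qed.

Lemma twist1 : T 1 = 1.
Proof.
have Tl0 : T l != 0 by rewrite twist_iota emb_eq0 Ctwist_eq0 -emb_eq0 ell_neq0.
by apply: (mulIf Tl0); rewrite -twistM !mul1r.
Qed.

Lemma twist_cst c : T (cst c) = cst c.
Proof.
rewrite /Qcst twist_frac -?emb_eq0 ?ell_neq0//; apply/eqP.
rewrite eqr_div ?ell_neq0 ?emb_eq0 ?Ctwist_eq0// -?emb_eq0 ?ell_neq0//.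
rewrite mulrC -!embM; apply/eqP; congr iota; apply: Cplus_ext => t t0.
rewrite !conv_cst -!cintZ; try exact: ccont_Cplus.
by apply: eq_cint => u /andP[u0 _]; rewrite !CtwistE// !CcstE; ring.
Qed.

(** Solved for [T l], this is [T l = l / (1 - alpha l)], the counterpart in [Q] of [lmobE]. *)
Lemma twist_ell : T l = l + cst alpha * l * T l.
Proof.
rewrite /Qcst divfK ?ell_neq0// twist_iota {1}Ctwist_cst embD embM.
by [].
Qed.
End Twist.

Lemma twistK alpha : cancel (twist iota alpha) (twist iota (- alpha)).
Proof.
move=> x; have [f [g [g0 ->]]] := fracP x.
by rewrite !twist_frac ?Ctwist_eq0// !CtwistK.
Qed.

Lemma twist_bij alpha : bijective (twist iota alpha).
Proof.
exists (twist iota (- alpha)); first exact: twistK.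
by move=> x; rewrite -{1}[alpha]opprK twistK.
Qed.

Lemma twist_transforming alpha : is_transforming (twist iota alpha).
Proof.
split; [exact: twistB|split; [exact: twist1|exact: twistM]|exact: can_inj (twistK alpha)].
Qed.

Local Notation D := (dds iota).

(** Independence of the chosen representation: the Leibniz rule applied to the cross-multiplied
    identity expresses [Cder f] through the other data, and field algebra does the rest. *)
Lemma dds_frac f g : g != 0 -> D (iota f / iota g) =
  (iota (Cder f) * iota g - iota f * iota (Cder g)) / iota g ^+ 2.
Proof.
move=> g0; rewrite /dds; have := frac_reprP (iota f / iota g).
case: (frac_repr _ _) => F G /= [G0 e0].
have e1 := frac_eq g0 G0 e0.
have := congr1 iota (congr1 (@Cder R) e1); rewrite !Cder_conv !embD !embM => e2.
have := congr1 iota e1; rewrite !embM => {}e1.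
rewrite -(emb_eq0 g) -(emb_eq0 G) in g0 G0.
have E : iota f = iota F * iota g / iota G by rewrite -e1 mulfK.
have E2 : iota (Cder f) = (iota (Cder F) * iota g + iota F * iota (Cder g) - iota f * iota (Cder G)) / iota G.
  by rewrite -e2 addrK mulfK.
by rewrite E2 E; field; rewrite g0 G0.
Qed.

Lemma dds_iota f : D (iota f) = iota (Cder f).
Proof.
have l0 := ell_neq0.
rewrite -[iota f](mulfK l0) -embM dds_frac -?emb_eq0// Cder_conv embD !embM.
by rewrite -[iota (Ccst 1)]/l; field.
Qed.

Lemma ddsD x y : D (x + y) = D x + D y.
Proof.
have [f [g [g0 ->]]] := fracP x; have [f' [g' [g'0 ->]]] := fracP y.
rewrite addf_div ?emb_eq0// -!embM -embD !dds_frac//; last first.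
  by rewrite -emb_eq0 embM mulf_neq0 ?emb_eq0.
rewrite CderD !Cder_conv !embD !embM.
by rewrite -(emb_eq0 g) -(emb_eq0 g') in g0 g'0; field; rewrite g0 g'0.
Qed.

Lemma ddsM x y : D (x * y) = D x * y + x * D y.
Proof.
have [f [g [g0 ->]]] := fracP x; have [f' [g' [g'0 ->]]] := fracP y.
rewrite mulf_div -!embM !dds_frac//; last first.
  by rewrite -emb_eq0 embM mulf_neq0 ?emb_eq0.
rewrite !Cder_conv !embD !embM.
by rewrite -(emb_eq0 g) -(emb_eq0 g') in g0 g'0; field; rewrite g0 g'0.
Qed.

Lemma dds_derivation : is_derivation D.
Proof. split; [exact: ddsD|exact: ddsM]. Qed.

Lemma dds_ell : D l = - l ^+ 2.
Proof. by rewrite dds_iota Cder_cst embN embM. Qed.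

(** If the ratio of the two normalisers is [A / B], then [conv A (g n) = conv B (g' n)] for all [n].
    Convolution is continuous, so the same holds for the limits. *)
Lemma Qlim_unique u x y : Qlim iota u x -> Qlim iota u y -> x = y.
Proof.
move=> [p [g [h [p0 ug gh ->]]]] [p' [g' [h' [p'0 ug' gh' ->]]]].
have [A [B [B0 e]]] := fracP (p / p').
rewrite -(emb_eq0 B) in B0.
have eg n : conv A (g n) = conv B (g' n).
  apply: emb_inj; rewrite !embM -ug -ug'.
  have -> : iota A = p / p' * iota B by rewrite e divfK.
  by field; rewrite p0 p'0.
have eh : conv A h = conv B h'.
  have c1 := ucvg_conv A ((ucvgP _ _).1 gh); have c2 := ucvg_conv B ((ucvgP _ _).1 gh').
  apply: ucvg_unique c1 _; move: c2; congr ucvg.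
  by apply/funext => n; rewrite eg.
have := congr1 iota eh; rewrite !embM.
have -> : iota A = p / p' * iota B by rewrite e divfK.
move=> E.
apply: (mulfI (mulf_neq0 B0 (invr_neq0 p'0))).
rewrite (_ : _ * (p * _) = p / p' * iota B * iota h); last by ring.
by rewrite E; field.
Qed.

End FractionFieldTheory.

(** * Convergent series in [l]: ring operations, [T^alpha] and [d/ds] *)

Section SeriesInEll.
Variables (R : realType) (Q : fieldType) (iota : Cplus R -> Q).
Hypothesis hQ : is_fraction_field iota.
Implicit Types (f g h : Cplus R) (x y q : Q) (a b : nat -> R[i]).
Local Notation conv := Defs.conv.
Local Notation l := (ell iota).
Local Notation cst := (Qcst iota).

Let l0 := ell_neq0 hQ.

Definition ell_series a : Q := iota (borel a) / l.
Local Notation S := ell_series.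

Lemma ell_seriesK a : S a * l = iota (borel a).
Proof. by rewrite divfK. Qed.

Lemma cstK c : cst c * l = iota (Ccst c).
Proof. by rewrite divfK. Qed.

Lemma emb_monomial c n : iota (monomial c n) = cst c * l ^+ n.+1.
Proof.
elim: n c => [|n IH] c; first by rewrite monomial0 expr1 cstK.
by rewrite -[in LHS](mul1r c) -conv_monomial (embM hQ) IH mulrCA -exprS.
Qed.

Lemma emb_borel_sum a n : iota (borel_sum a n) = \sum_(0 <= k < n) cst (a k) * l ^+ k.+1.
Proof.
elim: n => [|n IH]; first by rewrite /borel_sum !big_geq// (emb0 hQ).
by rewrite borel_sumS (embD hQ) IH emb_monomial big_nat_recr.
Qed.

Lemma ell_series_Qsums a : convergent_series a ->
  Qsums_to iota 0 (fun n => cst (a n) * l ^+ n) (S a).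
Proof.
(* Dividing by [p = 1 / l] multiplies by [l], which turns every term, the constant one included,
   into a function. *)
move=> ca; exists l^-1, (borel_sum a), (borel a); split.
- by rewrite invr_eq0.
- move=> n; rewrite emb_borel_sum invrK mulr_suml; apply: eq_bigr => k _.
  by rewrite exprSr mulrA.
- exact/ucvgP/borel_ucvg.
- by rewrite mulrC.
Qed.

Lemma ell_series_unique a x : convergent_series a ->
  Qsums_to iota 0 (fun n => cst (a n) * l ^+ n) x -> x = S a.
Proof. by move=> ca /(Qlim_unique hQ); apply; exact: ell_series_Qsums. Qed.

Lemma ClP x : Cl iota x <-> exists2 a, convergent_series a & x = S a.
Proof.
split=> -[a ca]; first by move=> /(ell_series_unique ca) ->; exists a.
by move=> ->; exists a => //; exact: ell_series_Qsums.
Qed.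

Lemma ell_series_rec a : convergent_series a -> S a = cst (a 0%N) + l * S (seq_tail a).
Proof.
move=> ca; have := congr1 iota (borel_rec ca).
rewrite (embB hQ) (embM hQ) -ell_seriesK -cstK -ell_seriesK => e.
apply: (mulIf l0); rewrite mulrDl; apply/eqP; rewrite addrC -subr_eq e.
by rewrite /ell mulrA.
Qed.

Lemma ell_seriesD a b : convergent_series a -> convergent_series b ->
  S (fun n => a n + b n) = S a + S b.
Proof. by move=> ca cb; rewrite /ell_series borelD// (embD hQ) mulrDl. Qed.

Lemma ell_seriesZ c a : convergent_series a -> S (fun n => c * a n) = cst c * S a.
Proof.
move=> ca; have := congr1 iota (conv_borelZ c ca); rewrite !(embM hQ) -!ell_seriesK -(cstK c).
rewrite -[iota (Ccst 1)]/l => e.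
by apply: (mulfI l0); apply: (mulIf l0); rewrite -[LHS]mulrA e; ring.
Qed.

Lemma cst0 : cst 0 = 0.
Proof.
rewrite /Qcst (_ : Ccst 0 = 0) ?(emb0 hQ) ?mul0r//.
by apply: Cplus_ext => t _; rewrite CcstE Cplus0.
Qed.

Lemma cst1 : cst 1 = 1.
Proof. by rewrite /Qcst divff. Qed.

Lemma ell_series_scons a : convergent_series a -> S (scons a) = l * S a.
Proof.
by move=> ca; rewrite (ell_series_rec (cvs_scons ca)) /= cst0 add0r.
Qed.

Lemma cvs0 : convergent_series (fun=> 0 : R[i]).
Proof.
by apply: (@geo_convergent _ 0 0); split=> // n; rewrite cnrm0 mul0r.
Qed.

Lemma cvs1 : convergent_series (fun n => if n is 0 then 1 else 0 : R[i]).
Proof.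
apply: (@geo_convergent _ 1 0); split=> // -[|n].
  by rewrite cnrm1 expr0 mulr1.
by rewrite cnrm0 mul1r exprn_ge0.
Qed.

Lemma ell_series0 : S (fun=> 0) = 0.
Proof.
by have := ell_seriesZ 0 cvs0; rewrite mul0r cst0 mul0r.
Qed.

Lemma ell_series1 : S (fun n => if n is 0 then 1 else 0) = 1.
Proof. by rewrite (ell_series_rec cvs1) cst1 [X in S X](_ : _ = fun=> 0)// ell_series0 mulr0 addr0. Qed.

Lemma ell_seriesB a b : convergent_series a -> convergent_series b ->
  S (fun n => a n + -1 * b n) = S a - S b.
Proof.
move=> ca cb; rewrite ell_seriesD//; last exact: cvsZ.
congr (_ + _); apply/eqP; rewrite -addr_eq0 -ell_seriesD//; last exact: cvsZ.
by rewrite (_ : (fun n => _) = fun=> 0) ?ell_series0//; apply/funext => n; rewrite mulN1r addNr.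
Qed.

Lemma borel_at0 a : convergent_series a -> borel a 0 = a 0%N.
Proof.
move=> ca; have := congr1 (fun f : Cplus R => f 0) (borel_rec ca).
rewrite CplusB conv_cst (_ : cint _ 0 = 0); last first.
  by rewrite /cint set_itv1 !Rintegral_set1.
by rewrite mulr0 CcstE => /eqP; rewrite subr_eq0 => /eqP.
Qed.

(** The value of [borel a] at 0 is [a_0]; once it is 0, [S a = l S a'] and [l] cancels, which leaves
    the tail. *)
Lemma ell_series_eq0 a : convergent_series a -> S a = 0 -> a = fun=> 0.
Proof.
have head c : convergent_series c -> S c = 0 -> c 0%N = 0.
  move=> cc Sc; have := ell_seriesK c; rewrite Sc mul0r => /esym/eqP.
  by rewrite (emb_eq0 hQ) => /eqP b0; rewrite -borel_at0// b0.
move=> ca Sa; apply/funext => n; elim: n a ca Sa => [|n IH] a ca Sa; first exact: head.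
apply: (IH (seq_tail a)); first exact: cvs_tail.
have := ell_series_rec ca; rewrite Sa head// cst0 add0r => /esym/eqP.
by rewrite mulf_eq0 (negbTE l0) => /eqP.
Qed.

Lemma ell_series_inj a b : convergent_series a -> convergent_series b ->
  S a = S b -> a = b.
Proof.
move=> ca cb /eqP; rewrite -subr_eq0 -ell_seriesB// => /eqP h.
have e := ell_series_eq0 (cvsD ca (cvsZ (-1) cb)) h.
apply/funext => n; have := congr1 (fun f : nat -> R[i] => f n) e.
by rewrite /= mulN1r => /eqP; rewrite subr_eq0 => /eqP.
Qed.

Lemma cauchy_prodE a b : cauchy_prod a b =
  (fun n => a 0%N * b n + scons (cauchy_prod (seq_tail a) b) n).
Proof. by apply/funext => -[]. Qed.

Lemma ell_seriesM a b : convergent_series a -> convergent_series b ->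
  S (cauchy_prod a b) = S a * S b.
Proof.
move=> ca cb.
(* The function represents [l ^ 2] times the defect. In its recursion the terms [c_0 S b] cancel and
   one factor [l] comes out. *)
pose F c : Cplus R := conv (borel c) (borel b) - conv (Ccst 1) (borel (cauchy_prod c b)).
have FE c : iota (F c) = l ^+ 2 * (S c * S b - S (cauchy_prod c b)).
  by rewrite (embB hQ) !(embM hQ) -!ell_seriesK -[iota (Ccst 1)]/l; ring.
suff /eqP : F a = 0.
  rewrite -(emb_eq0 hQ) FE mulf_eq0 expf_eq0 (negbTE l0) andbF /= subr_eq0.
  by move=> /eqP.
apply: defect_eq0 ca => {a} [c cc|M T M0].
  apply: (emb_inj hQ); rewrite (embM hQ) !FE -[iota (Ccst 1)]/l.
  rewrite cauchy_prodE ell_seriesD ?ell_seriesZ//; last 2 first.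
  - exact: cvsZ.
  - exact/cvs_scons/cvs_cauchy/cb/cvs_tail.
  rewrite ell_series_scons; last exact/cvs_cauchy/cb/cvs_tail.
  by rewrite (ell_series_rec cc); ring.
have [C' [M' bM]] := convergent_geo cb.
exists (2 * expR (M * T) * (2 * expR (M' * T) * C') * `|T| +
  `|T| * (2 * expR ((M + M') * T) * C')).
move=> C c t cM tT; rewrite CplusB.
have [t0 tT'] : 0 <= t /\ t <= `|T|.
  by case/andP: tT => ? ?; split=> //; apply: le_trans (ler_norm T).
apply: le_trans (cnrmB _ _) _; rewrite mulrDl; apply: lerD.
  have h := cnrm_conv_le_cst tT (fun u uT => borel_le cM uT) (fun u uT => borel_le bM uT).
  apply: le_trans h _.
  have [C0 _ _] := cM; have [C'0 _ _] := bM.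
  rewrite [leRHS](_ : _ = (2 * expR (M * T) * C * (2 * expR (M' * T) * C')) * `|T|); last by ring.
  by rewrite ler_wpM2l// !mulr_ge0 ?expR_ge0.
have h := @cnrm_conv_le_cst _ (Ccst 1) _ 1 _ T t tT _ (fun u uT => borel_le (geo_cauchy cM bM) uT).
apply: le_trans (h _) _; first by move=> u _; rewrite CcstE cnrm1.
have [C0 _ _] := cM; have [C'0 _ _] := bM.
rewrite [leRHS](_ : _ = 1 * (2 * expR ((M + M') * T) * (C * C')) * `|T|); last by ring.
by rewrite ler_wpM2l// !mulr_ge0 ?expR_ge0.
Qed.

Section Mobius.
Variable alpha : R[i].
Local Notation T := (twist iota alpha).

(** The algebra of the germ identity with [l] in place of [Z] and [T l] in place of [w], resting on
    [(1 - alpha l) T l = l]. *)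
Lemma ell_series_mobius_rec a : convergent_series a ->
  S (mobius alpha a) = cst (a 0%N) + T l * S (mobius alpha (seq_tail a)).
Proof.
move=> ca; have cb := cvs_mobius alpha ca; have cb' := cvs_tail cb.
have cm := cvs_mobius alpha (cvs_tail ca).
rewrite (ell_series_rec cb) mobius0; congr (_ + _).
have e : S (seq_tail (mobius alpha a)) =
    S (mobius alpha (seq_tail a)) + cst alpha * (l * S (seq_tail (mobius alpha a))).
  rewrite -ell_series_scons// -ell_seriesZ//; last exact: cvs_scons.
  rewrite -ell_seriesD//; last exact/cvsZ/cvs_scons.
  congr S; apply/funext => n; rewrite {1}/seq_tail mobiusS; congr (_ + _).
  by case: n => [|n]; rewrite /= ?mulr0.
have -> : S (mobius alpha (seq_tail a)) =
    (1 - cst alpha * l) * S (seq_tail (mobius alpha a)).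
  by rewrite mulrBl mul1r -mulrA {1}e addrK.
rewrite [RHS]mulrA; congr (_ * _).
by rewrite mulrBr mulr1 {1}(twist_ell hQ); ring.
Qed.

Lemma twist_ell_neq0 : T l != 0.
Proof. by rewrite (twist_iota hQ) (emb_eq0 hQ) Ctwist_eq0 -(emb_eq0 hQ). Qed.

Lemma twist_ell_series a : convergent_series a -> T (S a) = S (mobius alpha a).
Proof.
move=> ca.
pose G c : Cplus R := conv (Ccst 1) (Ctwist alpha (borel c)) -
  conv (Ctwist alpha (Ccst 1)) (borel (mobius alpha c)).
have GE c : iota (G c) = l * T l * (T (S c) - S (mobius alpha c)).
  rewrite (embB hQ) !(embM hQ) -!(twist_iota hQ) -!ell_seriesK (twistM hQ).
  by rewrite -[iota (Ccst 1)]/l; ring.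
(* [G] satisfies its recursion with factor [T l], whereas [defect_eq0] requires [l]. The inverse
   twist sends [T l] back to [l]. *)
suff /eqP : Ctwist (- alpha) (G a) = 0.
  rewrite Ctwist_eq0 -(emb_eq0 hQ) GE !mulf_eq0 (negbTE l0).
  by rewrite (negbTE twist_ell_neq0) /= subr_eq0 => /eqP.
apply: (@defect_eq0 _ (fun c => Ctwist (- alpha) (G c))) ca => {a} [c cc|M t M0].
  rewrite -[Ccst 1](CtwistK alpha) -Ctwist_conv; congr Ctwist.
  apply: (emb_inj hQ); rewrite (embM hQ) !GE -(twist_iota hQ) -[iota (Ccst 1)]/l.
  rewrite (ell_series_mobius_rec cc) {1}(ell_series_rec cc).
  have TD x y : T (x + y) = T x + T y.
    by have := twistB hQ alpha (x + y) y; rewrite addrK => ->; rewrite subrK.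
  by rewrite TD (twistM hQ) (twist_cst hQ); ring.
have [K1 K10 K1P] := cnrm_bounded (Ctwist (- alpha) (Ccst (1 : R[i]))) t.
have [K2 K20 K2P] := cnrm_bounded (Ctwist alpha (Ccst (1 : R[i]))) t.
(* [K1] pays for the outer inverse twist and [K2] for the twist inside either convolution; [|t|]
   bounds the length of the interval. *)
exists (K1 * (K2 * (2 * expR (M * t)) * `|t| + K2 * (2 * expR ((M + cnrm alpha) * t)) * `|t|)).
move=> C c s cM st.
have [s0 st'] : 0 <= s /\ s <= `|t|.
  by case/andP: st => ? ?; split=> //; apply: le_trans (ler_norm t).
have [C0 _ _] := cM.
have tw beta (h : Cplus R) u : 0 <= u ->
    Ctwist beta h u = Ctwist beta (Ccst 1) u * h u.
  by move=> u0; rewrite !CtwistE// CcstE mulr1.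
rewrite tw// -[leRHS]mulrA; apply: le_trans (cnrmM _ _) _.
apply: ler_pM; rewrite ?cnrm_ge0 ?K1P//.
rewrite CplusB; apply: le_trans (cnrmB _ _) _; rewrite mulrDl; apply: lerD.
  have h1 u : 0 <= u <= t -> cnrm (Ctwist alpha (borel c) u) <= K2 * (2 * expR (M * t) * C).
    move=> ut; rewrite tw; last by case/andP: ut.
    by apply: le_trans (cnrmM _ _) _; rewrite ler_pM ?cnrm_ge0 ?K2P// borel_le.
  have h := @cnrm_conv_le_cst _ (Ccst 1) _ 1 _ t s st _ h1.
  apply: le_trans (h _) _; first by move=> u _; rewrite CcstE cnrm1.
  rewrite [leRHS](_ : _ = 1 * (K2 * (2 * expR (M * t) * C)) * `|t|); last by ring.
  by rewrite ler_wpM2l// !mulr_ge0 ?expR_ge0.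
have h := cnrm_conv_le_cst st K2P (fun u ut => borel_le (geo_mobius alpha cM) ut).
apply: le_trans h _.
rewrite [leRHS](_ : _ = K2 * (2 * expR ((M + cnrm alpha) * t) * C) * `|t|); last by ring.
by rewrite ler_wpM2l// !mulr_ge0 ?expR_ge0.
Qed.
End Mobius.

(** From [D (S a * l)] and [D l = - l ^ 2] one gets [D (S a) = S (der_coef a) + l S a]; the last
    term lowers the factor [n + 1] to [n]. *)
Definition lder_coef a (n : nat) : R[i] := if n is m.+1 then - m%:R * a m else 0.

Lemma lder_coefE a : lder_coef a = (fun n => der_coef a n + scons a n).
Proof.
apply/funext => -[|n] /=; first by rewrite addr0.
by rewrite -[n.+1]addn1 natrD; ring.
Qed.

Lemma cvs_lder a : convergent_series a -> convergent_series (lder_coef a).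
Proof. by move=> ca; rewrite lder_coefE; apply: cvsD; [exact: cvs_der|exact: cvs_scons]. Qed.

Lemma dds_ell_series a : convergent_series a -> dds iota (S a) = S (lder_coef a).
Proof.
move=> ca; rewrite lder_coefE ell_seriesD ?ell_series_scons//; last 2 first.
- exact: cvs_der.
- exact: cvs_scons.
have := ddsM hQ (S a) l; rewrite ell_seriesK (dds_ell hQ) (dds_iota hQ) Cder_borel// -ell_seriesK.
move=> e; apply: (mulIf l0); rewrite mulrDl e; ring.
Qed.

Lemma dds_Qsums a : convergent_series a ->
  Qsums_to iota 1 (fun n => cst (- n%:R * a n) * l ^+ n.+1) (dds iota (S a)).
Proof.
move=> ca; rewrite dds_ell_series//; have cd := cvs_lder ca.
(* Term [k] of the claimed series is term [k + 1] of [lder_coef a], hence [n.+1]. The extra terms,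
   index 0 of either sequence, vanish. *)
exists l^-1, (fun n => borel_sum (lder_coef a) n.+1), (borel (lder_coef a)); split.
- by rewrite invr_eq0.
- move=> n; rewrite emb_borel_sum invrK big_nat_recl//= cst0 mul0r add0r mulr_suml.
  case: n => [|n]; first by rewrite !big_geq.
  rewrite [RHS]big_nat_recl//= oppr0 mul0r cst0 mul0r add0r big_add1 /=.
  by apply: eq_bigr => k _; rewrite [in RHS]exprSr mulrA.
- by apply/ucvgP/ucvg_shift/borel_ucvg.
- by rewrite mulrC.
Qed.

End SeriesInEll.

(** * Derivations and transforming operators on quotients *)

Section FieldOperators.
Variables (F : fieldType) (D T : F -> F).

Lemma derivation_div x y : is_derivation D -> y != 0 ->
  D (x / y) = (D x * y - x * D y) / y ^+ 2.
Proof.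
move=> [_ DM] y0; have := DM (x / y) y; rewrite divfK// => ->.
by field.
Qed.

Lemma transforming_neq0 y : is_transforming T -> y != 0 -> T y != 0.
Proof.
move=> [TB _ Tinj]; apply: contra_neq => Ty; apply: Tinj.
by rewrite Ty; have := TB 0 0; rewrite !subrr.
Qed.

Lemma transforming_div x y : is_transforming T -> y != 0 -> T (x / y) = T x / T y.
Proof.
move=> hT y0; have Ty0 := transforming_neq0 hT y0; case: hT => _ [_ TM] _.
by apply: (mulIf Ty0); rewrite divfK// -TM divfK.
Qed.
End FieldOperators.

(** * The embedding of the quotient field into formal Laurent series *)

Section LaurentEmbedding.
Variables (R : realType) (Q : fieldType) (iota : Cplus R -> Q).
Hypothesis hQ : is_fraction_field iota.
Variable alpha : R[i].
Implicit Types (x y q : Q) (a b c d : nat -> R[i]).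
Local Notation S := (ell_series iota).
Local Notation D := (dds iota).
Local Notation T := (twist iota alpha).
Local Notation cvs := (@convergent_series R).
Local Notation L := (laurent R[i]).

Lemma QClP x : QCl iota x <->
  exists a b, [/\ cvs a, cvs b, S b != 0 & x = S a / S b].
Proof.
split=> [[y [z [/(ClP hQ)[a ca ->] /(ClP hQ)[b cb ->] b0 ->]]]|[a [b [ca cb b0 ->]]]].
  by exists a, b.
by exists (S a), (S b); split=> //; apply/(ClP hQ); [exists a|exists b].
Qed.

Lemma lseries_neq0 b : S b != 0 -> lseries b != 0.
Proof.
apply: contra_neq => b0; rewrite (_ : b = fun=> 0) ?(ell_series0 hQ)//.
by apply: lseries_inj; rewrite b0; apply: laurentE => -[].
Qed.

(** Total on [Q], with value 0 outside [QCl]; [expansionE] shows that the chosen fraction does not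
    matter. *)
Definition expansion x : L :=
  xget 0 [set y | exists a b, [/\ cvs a, cvs b, S b != 0, x = S a / S b
    & y = lseries a / lseries b]].

(** Equality of two fractions in [Q] becomes an equality of [S] at two Cauchy products; [S] is
    injective, so the Cauchy products agree, and so do the Laurent fractions. *)
Lemma expansionE a b : cvs a -> cvs b -> S b != 0 ->
  expansion (S a / S b) = lseries a / lseries b.
Proof.
move=> ca cb b0; rewrite /expansion; case: xgetP => [y _ [c [d [cc cd d0 e ->]]]|].
  apply/eqP; rewrite eqr_div ?lseries_neq0// -!lseriesM; apply/eqP; congr lseries.
  apply: (ell_series_inj hQ); try exact: cvs_cauchy.
  rewrite !(ell_seriesM hQ)//; apply/eqP; rewrite -eqr_div// -e.
  by [].
by move=> /(_ (lseries a / lseries b))[]; exists a, b.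
Qed.

(** One pair [u], [v] represents the sum in both fields, so that closure of [QCl] and additivity of
    [expansion] are obtained together. *)
Lemma Cl_sum a b c d : cvs a -> cvs b -> cvs c -> cvs d -> S b != 0 -> S d != 0 ->
  let u := fun n => cauchy_prod a d n + cauchy_prod c b n in
  let v := cauchy_prod b d in
  [/\ cvs u, cvs v, S v != 0, S a / S b + S c / S d = S u / S v &
      lseries a / lseries b + lseries c / lseries d = lseries u / lseries v].
Proof.
move=> ca cb cc cd b0 d0 u v.
have cad := cvs_cauchy ca cd; have ccb := cvs_cauchy cc cb.
split.
- exact: cvsD.
- exact: cvs_cauchy.
- by rewrite (ell_seriesM hQ)// mulf_neq0.
- by rewrite addf_div// (ell_seriesD hQ)// !(ell_seriesM hQ).
- by rewrite addf_div ?lseries_neq0// lseriesD !lseriesM.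
Qed.

Lemma Cl_prod a b c d : cvs a -> cvs b -> cvs c -> cvs d -> S b != 0 -> S d != 0 ->
  let u := cauchy_prod a c in let v := cauchy_prod b d in
  [/\ cvs u, cvs v, S v != 0, (S a / S b) * (S c / S d) = S u / S v &
      (lseries a / lseries b) * (lseries c / lseries d) = lseries u / lseries v].
Proof.
move=> ca cb cc cd b0 d0 u v.
split; try exact: cvs_cauchy.
- by rewrite (ell_seriesM hQ)// mulf_neq0.
- by rewrite mulf_div !(ell_seriesM hQ).
- by rewrite mulf_div !lseriesM.
Qed.

Lemma expansionD x y : QCl iota x -> QCl iota y ->
  QCl iota (x + y) /\ expansion (x + y) = expansion x + expansion y.
Proof.
move=> /QClP[a [b [ca cb b0 ->]]] /QClP[c [d [cc cd d0 ->]]].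
have [cu cv v0 e1 e2] := Cl_sum ca cb cc cd b0 d0.
split; first by apply/QClP; rewrite e1; do 2 eexists; split; last by [].
by rewrite !expansionE// e2 e1 expansionE.
Qed.

Lemma expansionM x y : QCl iota x -> QCl iota y ->
  QCl iota (x * y) /\ expansion (x * y) = expansion x * expansion y.
Proof.
move=> /QClP[a [b [ca cb b0 ->]]] /QClP[c [d [cc cd d0 ->]]].
have [cu cv v0 e1 e2] := Cl_prod ca cb cc cd b0 d0.
split; first by apply/QClP; rewrite e1; do 2 eexists; split; last by [].
by rewrite !expansionE// e2 e1 expansionE.
Qed.

Lemma lseries1 : lseries (fun n => if n is 0 then 1 else 0 : R[i]) = 1.
Proof. by apply: laurentE => -[[|n]|n]; rewrite coefL1. Qed.

Lemma ell_series_QCl a : cvs a -> QCl iota (S a).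
Proof.
move=> ca; apply/QClP; exists a, (fun n => if n is 0 then 1 else 0).
by split; rewrite ?(ell_series1 hQ) ?oner_neq0 ?divr1//; exact: cvs1.
Qed.

Lemma expansion_ell_series a : cvs a -> expansion (S a) = lseries a.
Proof.
move=> ca; have := @expansionE a (fun n => if n is 0 then 1 else 0) ca (cvs1 R).
by rewrite (ell_series1 hQ) lseries1 !divr1; apply; exact: oner_neq0.
Qed.

Lemma QCl1 : QCl iota 1.
Proof. by rewrite -(ell_series1 hQ); apply: ell_series_QCl; exact: cvs1. Qed.

Lemma expansion1 : expansion 1 = 1.
Proof. by rewrite -(ell_series1 hQ) expansion_ell_series ?lseries1//; exact: cvs1. Qed.

Lemma expansion_inj x y : QCl iota x -> QCl iota y -> expansion x = expansion y -> x = y.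
Proof.
move=> /QClP[a [b [ca cb b0 ->]]] /QClP[c [d [cc cd d0 ->]]].
rewrite !expansionE// => /eqP; rewrite eqr_div ?lseries_neq0// -!lseriesM => /eqP/lseries_inj e.
by apply/eqP; rewrite eqr_div// -!(ell_seriesM hQ)// e.
Qed.

Lemma QClN x : QCl iota x -> QCl iota (- x).
Proof.
move=> /QClP[a [b [ca cb b0 ->]]]; apply/QClP; exists (fun n => -1 * a n), b; split=> //.
  exact: cvsZ.
have := ell_seriesB hQ (cvs0 R) ca; rewrite (ell_series0 hQ) sub0r.
rewrite (_ : (fun n => _) = (fun n => -1 * a n)) => [->|]; first by rewrite mulNr.
by apply/funext => n; rewrite add0r.
Qed.

Lemma QClV x : QCl iota x -> QCl iota x^-1.
Proof.
move=> /QClP[a [b [ca cb b0 ->]]]; have [a0|a0] := eqVneq (S a) 0.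
  by rewrite a0 mul0r invr0 -(ell_series0 hQ); apply: ell_series_QCl; exact: cvs0.
by apply/QClP; exists b, a; split=> //; rewrite invf_div.
Qed.

Lemma QClB x y : QCl iota x -> QCl iota y -> QCl iota (x - y).
Proof. by move=> hx /QClN hy; have [] := expansionD hx hy. Qed.

Lemma QCl_div x y : QCl iota x -> QCl iota y -> QCl iota (x / y).
Proof. by move=> hx /QClV hy; have [] := expansionM hx hy. Qed.

Lemma expansionB x y : QCl iota x -> QCl iota y ->
  expansion (x - y) = expansion x - expansion y.
Proof.
move=> hx hy; have [_] := expansionD (QClB hx hy) hy.
by rewrite subrK => ->; rewrite addrK.
Qed.

Lemma expansion_div x y : QCl iota x -> QCl iota y ->
  expansion (x / y) = expansion x / expansion y.
Proof.
move=> hx hy; have e0 : expansion 0 = 0.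
  by rewrite -(subrr (1 : Q)) (expansionB QCl1 QCl1) subrr.
have [->|y0] := eqVneq y 0; first by rewrite e0 !invr0 !mulr0.
have yy0 : expansion y != 0.
  apply: contra_neq y0 => ey; apply: expansion_inj => //; last by rewrite e0.
  by rewrite -(subrr (1 : Q)); exact: QClB QCl1 QCl1.
have [_] := expansionM (QCl_div hx hy) hy.
by rewrite divfK// => ->; rewrite mulfK.
Qed.

Lemma lder_derivation : is_derivation (@lder R[i]).
Proof. by split; [exact: lderD|exact: lderM]. Qed.

Lemma lsubst_transforming : is_transforming (@lsubst R[i] alpha).
Proof.
by split; [exact: lsubstB|split; [exact: lsubst1|exact: lsubstM]|exact: lsubst_inj].
Qed.

Lemma Cl_dds x : Cl iota x -> Cl iota (D x).
Proof.
move=> /(ClP hQ)[a ca ->]; apply/(ClP hQ); exists (lder_coef a); first exact: cvs_lder.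
exact: dds_ell_series.
Qed.

Lemma Cl_twist x : Cl iota x -> Cl iota (T x).
Proof.
move=> /(ClP hQ)[a ca ->]; apply/(ClP hQ); exists (mobius alpha a); first exact: cvs_mobius.
exact: twist_ell_series.
Qed.

(** Both derivations obey the quotient rule and act on series through the same [lder_coef]. *)
Lemma expansion_dds x : QCl iota x ->
  QCl iota (D x) /\ expansion (D x) = lder (expansion x).
Proof.
move=> /QClP[a [b [ca cb b0 ->]]].
have [ca' cb'] := (cvs_lder ca, cvs_lder cb).
have qa := ell_series_QCl ca; have qb := ell_series_QCl cb.
have qa' := ell_series_QCl ca'; have qb' := ell_series_QCl cb'.
have [q1 e1] := expansionM qa' qb; have [q2 e2] := expansionM qa qb'.
have [q3 e3] := expansionM qb qb; have q4 := QClB q1 q2.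
rewrite (derivation_div _ (dds_derivation hQ) b0) !(dds_ell_series hQ)// expr2.
split; first exact: QCl_div.
rewrite expansion_div// expansionB// e1 e2 e3 expansionE// !expansion_ell_series//.
rewrite (derivation_div _ lder_derivation (lseries_neq0 b0)) expr2.
by rewrite -!lseries_der.
Qed.

Lemma expansion_twist x : QCl iota x ->
  QCl iota (T x) /\ expansion (T x) = lsubst alpha (expansion x).
Proof.
move=> /QClP[a [b [ca cb b0 ->]]].
have [ca' cb'] := (cvs_mobius alpha ca, cvs_mobius alpha cb).
rewrite (transforming_div _ (twist_transforming hQ alpha) b0).
have b0' : S (mobius alpha b) != 0.
  by rewrite -(twist_ell_series hQ)//; exact: transforming_neq0 (twist_transforming hQ alpha) b0.
rewrite !(twist_ell_series hQ)// !expansionE//; split.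
  by apply/QClP; exists (mobius alpha a), (mobius alpha b).
by rewrite (transforming_div _ lsubst_transforming (lseries_neq0 b0)) !lseries_mobius.
Qed.

Lemma Cl_subring : DT_subring D T (Cl iota).
Proof.
split; last by split; [exact: Cl_dds|exact: Cl_twist].
split.
- apply/mem_set/(ClP hQ); exists (fun n => if n is 0 then 1 else 0); first exact: cvs1.
  by rewrite (ell_series1 hQ).
- move=> x y /set_mem/(ClP hQ)[a ca ->] /set_mem/(ClP hQ)[b cb ->].
  apply/mem_set/(ClP hQ); exists (fun n => a n + -1 * b n); first exact/cvsD/cvsZ.
  by rewrite (ell_seriesB hQ).
- move=> x y /set_mem/(ClP hQ)[a ca ->] /set_mem/(ClP hQ)[b cb ->].
  apply/mem_set/(ClP hQ); exists (cauchy_prod a b); first exact: cvs_cauchy.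
  by rewrite (ell_seriesM hQ).
Qed.

Lemma QCl_subfield : DT_subfield D T (QCl iota).
Proof.
split; last by split=> x hx; [have [] := expansion_dds hx|have [] := expansion_twist hx].
split.
- exact/mem_set/QCl1.
- by move=> x y /set_mem hx /set_mem hy; apply/mem_set; exact: QClB.
- by move=> x y /set_mem hx /set_mem hy; apply/mem_set; exact: QCl_div.
Qed.

Lemma expansion_subfield :
  DT_subfield (@lder R[i]) (lsubst alpha) (expansion @` QCl iota).
Proof.
split.
  split.
  - by apply/mem_set; exists 1; [exact: QCl1|exact: expansion1].
  - move=> _ _ /set_mem[x hx <-] /set_mem[y hy <-]; apply/mem_set.
    by exists (x - y); [exact: QClB|exact: expansionB].
  - move=> _ _ /set_mem[x hx <-] /set_mem[y hy <-]; apply/mem_set.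
    by exists (x / y); [exact: QCl_div|exact: expansion_div].
split=> _ [x hx <-].
  by have [h e] := expansion_dds hx; exists (D x).
by have [h e] := expansion_twist hx; exists (T x).
Qed.
End LaurentEmbedding.

Theorem theorem4p4 (R : realType) (Q : fieldType) (iota : Cplus R -> Q)
    (hQ : is_fraction_field iota) (alpha : R[i]) :
  let T := twist iota alpha in
  let D := dds iota in
  let l := ell iota in
  [/\ [/\ is_DT D T,
          bijective T,
          forall f, T (iota f) = iota (Ctwist alpha f),
          forall f, D (iota f) = iota (Cder f)
        & forall u x y, Qlim iota u x -> Qlim iota u y -> x = y],
      forall a, convergent_series a ->
        exists b x,
          [/\ convergent_series b,
              subst_germ alpha a b /\ lseries b = lsubst alpha (lseries a),
              Qsums_to iota 0 (fun n => Qcst iota (a n) * l ^+ n) x,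
              Qsums_to iota 0 (fun n => Qcst iota (b n) * l ^+ n) (T x)
            & Qsums_to iota 1
                (fun n => Qcst iota (- n%:R * a n) * l ^+ n.+1) (D x)],
      DT_subring D T (Cl iota),
      DT_subfield D T (QCl iota)
    & is_DT (@lder R[i]) (lsubst alpha) /\
      exists phi : Q -> laurent R[i],
        [/\ [/\ {in QCl iota &, {morph phi : x y / x + y}},
                {in QCl iota &, {morph phi : x y / x * y}},
                phi 1 = 1
              & {in QCl iota &, injective phi}],
            forall a x, convergent_series a ->
              Qsums_to iota 0 (fun n => Qcst iota (a n) * l ^+ n) x ->
              phi x = lseries a,
            {in QCl iota, {morph phi : x / D x >-> lder x}},
            {in QCl iota, {morph phi : x / T x >-> lsubst alpha x}}
          & DT_subfield (@lder R[i]) (lsubst alpha) (phi @` QCl iota)]].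
Proof.
move=> T D l; split.
- split.
  + by split; [exact: dds_derivation|exact: twist_transforming].
  + exact: twist_bij.
  + exact: twist_iota.
  + exact: dds_iota.
  + exact: Qlim_unique.
(* The single sequence [mobius alpha a] serves the germ, the formal substitution and the image under
   [T]. *)
- move=> a ca; exists (mobius alpha a), (ell_series iota a); split.
  + exact: cvs_mobius.
  + have [C [M aM]] := convergent_geo ca.
    by split; [exact: mobius_germ aM|exact: lseries_mobius].
  + exact: ell_series_Qsums.
  + by rewrite /T twist_ell_series//; apply: ell_series_Qsums => //; exact: cvs_mobius.
  + exact: dds_Qsums.
- exact: Cl_subring.
- exact: QCl_subfield.
- split; first by split; [exact: lder_derivation|exact: lsubst_transforming].
  exists (expansion iota); split.
  + split.
    * by move=> x y /set_mem hx /set_mem hy; have [] := expansionD hQ hx hy.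
    * by move=> x y /set_mem hx /set_mem hy; have [] := expansionM hQ hx hy.
    * exact: expansion1.
    * by move=> x y /set_mem hx /set_mem hy; exact: expansion_inj.
  + move=> a x ca /(ell_series_unique hQ ca) ->; exact: expansion_ell_series.
  + by move=> x /set_mem hx; have [] := expansion_dds hQ hx.
  + by move=> x /set_mem hx; have [] := expansion_twist hQ alpha hx.
  + exact: expansion_subfield.
Qed.
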